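(* Let $G$ be a finitely generated group of polynomial volume growth, $\mu\in\mathcal P_{\preceq}(G,\mathrm{reg})$, and let $(\Sigma_G,\mathfrak F_G)$ and $(\Sigma_N,\mathfrak F_N)$ be an adapted pair of geometries (built from a normal nilpotent subgroup $N$ of finite index). Then there are constants $0<c\le C<\infty$ such that $$c\|g\|_{\mathfrak F_G}\le\|g\|_{\mathfrak F_N}\le C\|g\|_{\mathfrak F_G}\qquad\text{for all } g\in N.$$
   Context: Notation. For positive functions $f_1,f_2$ on a set $D$, $f_1\asymp f_2$ means there are constants $0<c_1\le c_2<\infty$ with $c_1f_1\le f_2\le c_2f_1$ on $D$. For positive functions on $D=[1,\infty)$ (or on a neighbourhood of infinity), $f_1\preceq f_2$ means there are constants $c_1,c_2>0$ with $f_1(t)\le c_1f_2(c_2t)$ for all $t\in D$. A positive function $f$ is regularly varying of index $\gamma$ at infinity if $f(\lambda t)/f(t)\to\lambda^\gamma$ as $t\to\infty$ for every $\lambda>0$. Word length $|\cdot|$ w.r.t. a finite symmetric generating set; polynomial volume growth of degree $d$ means $\#\{|h|\le r\}\asymp r^d$ on $[1,\infty)$. The class $\mathcal P_{\preceq}(G,\mathrm{reg})$. $G$ is a finitely generated group of polynomial volume growth. $\mu=\sum_{i=0}^kp_i\mu_i$ with $k\ge0$, $p_0\ge0$, $p_i>0$ ($1\le i\le k$), $\sum p_i=1$, each $\mu_i$ a symmetric probability measure; $\mu_0$ finitely supported; for $1\le i\le k$, $\mu_i(h)\asymp[\phi_i(1+|h|_i)(1+|h|_i)^{d_i}]^{-1}$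 on a subgroup $H_i$ (word length $|\cdot|_i$, polynomial growth degree $d_i$) and $0$ off $H_i$, where $\phi_i$ is positive, increasing, regularly varying of positive index at infinity; the finite set $\{g:\mu(g)>\varepsilon\}$ generates $G$ and contains $e$ for some $\varepsilon>0$. $\Phi_0(t)=\max\{t,t^2\}$; for $1\le i\le k$, $\Phi_i(t)=t^2/\int_0^t\frac{2s}{\phi_i(s)}ds$ for $t\ge1$, extended linearly on $[0,1]$ with $\Phi_i(0)=0$; and for distinct $i,j\ge1$ either $\Phi_i\preceq\Phi_j$ or $\Phi_j\preceq\Phi_i$ near infinity. Weight function systems. Given a group $G$ and a finite tuple $\Sigma$ of elements of $G$ (regarded also as abstract letters), a weight function system $\mathfrak F=\{F_s:s\in\Sigma\}$ is a family of continuous strictly increasing functions $F_s:[0,\infty)\to[0,\infty)$ with $F_s(t)\asymp t$ on $[0,1]$, such that for all $s,s'\in\Sigma$ either $F_s\preceq F_{s'}$ or $F_{s'}\preceq F_s$ on a neighbourhood of infinity. For a finite word $\omega$ over $\Sigma\cup\Sigma^{-1}$ (formal inverses) and $s\in\Sigma$, $\deg_s(\omega)$ is the number of occurrences of the letters $s$ or $s^{-1}$ in $\omega$. For $g\in G$, $\|g\|_{\mathfrak F}=\inf\{\max_{s\in\Sigma}F_s^{-1}(\deg_s(\omega)):\ \omega \text{ a finite word over }\Sigma\cup\Sigma^{-1}\text{ equal to } g \text{ in } G\}$, with $\|e\|_{\mathfrak F}=0$ and $\|g\|_{\mathfrak F}=\infty$ if no such word exists. Adapted geometries. Fix a normal nilpotent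 subgroup $N$ of finite index in $G$ and coset representatives $u_0=e,u_1,\dots,u_m$ with $G=\bigsqcup_\ell Nu_\ell$. Let $N_i=N\cap H_i$ ($1\le i\le k$), $S_0$ a finite symmetric generating set of $G$, and $S_i$ a finite symmetric generating set of $N_i$ ($1\le i\le k$). Let $\Sigma_G$ be a set of representatives of $(\bigcup_{i=0}^kS_i)\setminus\{e\}$ modulo $g\sim g^{-1}$, and $F_{G,s}=\max\{\Phi_i^{-1}: 0\le i\le k,\ s\in S_i\}$ for $s\in\Sigma_G$; $\mathfrak F_G=\{F_{G,s}\}$. Let $\Xi_0$ be a finite symmetric generating set of $N$, $\Xi_i=\bigcup_{\ell=0}^m u_\ell S_iu_\ell^{-1}$ ($1\le i\le k$), $\Sigma_N$ a set of representatives of $(\bigcup_{i=0}^k\Xi_i)\setminus\{e\}$ modulo $g\sim g^{-1}$, and $F_{N,s}=\max\{\Phi_i^{-1}: 0\le i\le k,\ s\in\Xi_i\}$; $\mathfrak F_N=\{F_{N,s}\}$ (a weight function system on the group $N$). *)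

(* Defs.v *)
From Stdlib Require Import Reals Lra List Arith Classical ClassicalEpsilon.
Import ListNotations.
Open Scope R_scope.

Record group := Group {
  gcar :> Type;
  gmul : gcar -> gcar -> gcar;
  ginv : gcar -> gcar;
  gone : gcar;
  gmulA : forall x y z, gmul x (gmul y z) = gmul (gmul x y) z;
  gmul1l : forall x, gmul gone x = x;
  gmulVl : forall x, gmul (ginv x) x = gone
}.
Arguments gmul {g}. Arguments ginv {g}. Arguments gone {g}.

Section GroupDefs.
Variable G : group.

Definition gprod (l : list G) : G := fold_right gmul gone l.

Definition is_subgroup (H : G -> Prop) : Prop :=
  H gone /\ (forall x y, H x -> H y -> H (gmul x y)) /\ (forall x, H x -> H (ginv x)).

Definition is_normal (N : G -> Prop) : Prop :=
  forall g x, N x -> N (gmul (gmul g x) (ginv g)).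

Definition gen_by (A : G -> Prop) (z : G) : Prop :=
  exists l : list G, Forall (fun a => A a \/ A (ginv a)) l /\ gprod l = z.

Definition gcomm (x y : G) : G := gmul (gmul (ginv x) (ginv y)) (gmul x y).

Fixpoint lcs (N : G -> Prop) (n : nat) : G -> Prop :=
  match n with
  | O => N
  | S n' => gen_by (fun z => exists x y, lcs N n' x /\ N y /\ z = gcomm x y)
  end.

Definition is_nilpotent (N : G -> Prop) : Prop :=
  exists n, forall z, lcs N n z -> z = gone.

Definition fin_sym_gen (H : G -> Prop) (S : list G) : Prop :=
  (forall s, In s S -> H s) /\ (forall s, In s S -> In (ginv s) S) /\
  (forall h, H h -> exists l, Forall (fun a => In a S) l /\ gprod l = h).

Definition wlen (S : list G) (h : G) (n : nat) : Prop :=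
  (exists l, Forall (fun a => In a S) l /\ gprod l = h /\ length l = n) /\
  (forall l, Forall (fun a => In a S) l -> gprod l = h -> (n <= length l)%nat).

Definition ball_card (S : list G) (r : R) (m : nat) : Prop :=
  exists B : list G, NoDup B /\ length B = m /\
    (forall h, In h B <-> exists n, wlen S h n /\ INR n <= r).

Definition poly_growth (S : list G) (d : nat) : Prop :=
  exists c1 c2, 0 < c1 /\ 0 < c2 /\
    forall r, 1 <= r -> exists m, ball_card S r m /\
       c1 * r ^ d <= INR m /\ INR m <= c2 * r ^ d.

Definition sums_to (f : G -> R) (s : R) : Prop :=
  is_lub (fun x => exists l : list G, NoDup l /\ x = fold_right Rplus 0 (map f l)) s.

Definition sym_prob (m : G -> R) : Prop :=
  (forall g, 0 <= m g) /\ (forall g, m (ginv g) = m g) /\ sums_to m 1.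

Definition rep_set (A : G -> Prop) (Sigma : list G) : Prop :=
  NoDup Sigma /\ (forall s, In s Sigma -> A s) /\
  (forall x, A x -> exists! s, In s Sigma /\ (s = x \/ s = ginv x)).

Definition letter_val (Sigma : list G) (a : nat * bool) : G :=
  if snd a then ginv (nth (fst a) Sigma gone) else nth (fst a) Sigma gone.

Definition word_eval (Sigma : list G) (w : list (nat * bool)) : G :=
  gprod (map (letter_val Sigma) w).

Definition deg (i : nat) (w : list (nat * bool)) : nat :=
  length (filter (fun a => Nat.eqb (fst a) i) w).

Definition maxR (n : nat) (t : nat -> R) : R := fold_right Rmax 0 (map t (seq 0 n)).

(** r = max_s F_s^{-1}(deg_s w) for some word w equal to g
    (t i is the value F_i^{-1}(deg_i w), i.e. the u >= 0 with F_i u = deg_i w) *)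
Definition wnorm_vals (Sigma : list G) (F : nat -> R -> R) (g : G) (r : R) : Prop :=
  exists w : list (nat * bool),
    Forall (fun a => (fst a < length Sigma)%nat) w /\ word_eval Sigma w = g /\
    exists t : nat -> R,
      (forall i, (i < length Sigma)%nat -> 0 <= t i /\ F i (t i) = INR (deg i w)) /\
      r = maxR (length Sigma) t.

Definition is_glb (E : R -> Prop) (x : R) : Prop :=
  (forall y, E y -> x <= y) /\ (forall b, (forall y, E y -> b <= y) -> b <= x).

(** ||g||_F = x  (finite value); no such x means ||g||_F = +oo *)
Definition is_wnorm (Sigma : list G) (F : nat -> R -> R) (g : G) (x : R) : Prop :=
  (g = gone /\ x = 0) \/ (g <> gone /\ is_glb (wnorm_vals Sigma F g) x).

End GroupDefs.

Definition inv_on (f : R -> R) (y : R) : R :=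
  epsilon (inhabits 0) (fun u => 0 <= u /\ f u = y).

Definition integral0 (f : R -> R) (t : R) : R :=
  epsilon (inhabits 0) (fun I => exists pr : Riemann_integrable f 0 t, RiemannInt pr = I).

Definition PhiReg (phi : R -> R) (t : R) : R :=
  let I := integral0 (fun s => 2 * s / phi s) in
  if Rle_dec 1 t then t ^ 2 / I t else t * (1 ^ 2 / I 1).

Definition PhiAll (phi : nat -> R -> R) (i : nat) : R -> R :=
  match i with O => fun t => Rmax t (t ^ 2) | S _ => PhiReg (phi i) end.

Definition regularly_varying_pos (phi : R -> R) : Prop :=
  exists gam, 0 < gam /\ forall lam, 0 < lam ->
    forall eps, 0 < eps -> exists T, forall t, T <= t ->
      Rabs (phi (lam * t) / phi t - Rpower lam gam) < eps.

Definition prec_inf (f1 f2 : R -> R) : Prop :=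
  exists c1 c2 T, 0 < c1 /\ 0 < c2 /\ forall t, T <= t -> f1 t <= c1 * f2 (c2 * t).

Definition wfun {G : group} (Phi : nat -> R -> R) (mem : nat -> G -> Prop) (k : nat)
    (s : G) (t : R) : R :=
  fold_right (fun i acc => if excluded_middle_informative (mem i s)
                           then Rmax acc (inv_on (Phi i) t) else acc) 0 (seq 0 (S k)).

Definition wsys {G : group} (Phi : nat -> R -> R) (mem : nat -> G -> Prop) (k : nat)
    (Sigma : list G) : nat -> R -> R :=
  fun j => wfun Phi mem k (nth j Sigma gone).

Definition Xi_mem {G : group} (u : list G) (Sg : nat -> list G) (Xi0 : list G)
    (i : nat) (x : G) : Prop :=
  match i with
  | O => In x Xi0
  | S _ => exists l, (l < length u)%nat /\ exists s, In s (Sg i) /\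
             x = gmul (gmul (nth l u gone) s) (ginv (nth l u gone))
  end.

(* Main.v *)
Require Import Defs.
From Stdlib Require Import Reals List Arith Classical ClassicalEpsilon.
From Stdlib Require Import Lra Lia.
From Coquelicot Require Import Rcomplements Hierarchy Continuity RInt RInt_analysis.
From Coquelicot Require AutoDerive.
Import ListNotations.
Open Scope R_scope.

(** From [G] to [N]: rewrite a word letter by letter with the coset representatives. A letter of
    [S_i], [i >= 1], lies in [N] and becomes one letter of [Xi_i]; a letter of [S_0] becomes boundedly
    many letters of [Xi_0], and [Phi_i] is dominated by [Phi_0].

    From [N] to [G]: replacing each [u s u^-1] separately would cost too many letters of [u]. But in a
    nilpotent group every word equals a product of boundedly many powers [sigma^x] of its letters,
    with [|x|] at most a constant times the degree of [sigma], and [(u s u^-1)^x = u s^x u^-1].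
    To see this, collect the letters in order of weight, treating formal commutators as new letters.
    The number of copies of a commutator is bounded by a constant times the product of the degrees of
    its leaves; such a power is, up to heavier commutators, a commutator of powers of the leaves, so
    that downward induction on the weight applies. *)

(** * Powers in nilpotent groups *)

Local Open Scope nat_scope.

(** The difficulty in passing from N to G is that collecting a word produces a commutator as often
    as the product of the degrees of its leaves, which may exceed every single degree. Such a power
    can never be written out letter by letter; it has to be traded for boundedly many powers of
    letters. Nilpotency leaves only finitely many formal commutators to treat, so the number of
    factors and all constants are independent of the word.

    Both directions compare words rather than norms. Bounding F_s^-1 at a degree means choosing one
    index i for the letter s, and on the side of N this index also decides whether a power is
    spelled out over S_0 or conjugated from a power in S_i. Constant factors in a degree are
    harmless because Phi_i(cx) <= c^2 Phi_i(x) for c >= 1, and bounded additional costs are harmless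
    because a nonempty word has weight bounded below.

    Returning to norms requires exact solutions of F_s(t) = deg. As phi_i is only nondecreasing,
    Phi_i may be constant on some [1, A], and then small degrees need not have a solution. *)

Section GroupFacts.
Variable G : group.
Implicit Types x y z : G.

Lemma gmulKl x y : gmul (ginv x) (gmul x y) = y.
Proof. now rewrite gmulA, gmulVl, gmul1l. Qed.

Lemma gmulVr x : gmul x (ginv x) = gone.
Proof.
  transitivity (gmul (gmul (ginv (ginv x)) (ginv x)) (gmul x (ginv x))).
  - now rewrite gmulVl, gmul1l.
  - now rewrite <- gmulA, (gmulKl x), gmulVl.
Qed.

Lemma gmul1r x : gmul x gone = x.
Proof. now rewrite <- (gmulVl G x), gmulA, gmulVr, gmul1l. Qed.

Lemma gmulKr x y : gmul x (gmul (ginv x) y) = y.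
Proof. now rewrite gmulA, gmulVr, gmul1l. Qed.

Lemma gmul_cancel_l x y z : gmul x y = gmul x z -> y = z.
Proof. intros E. rewrite <- (gmulKl x y), E. apply gmulKl. Qed.

Lemma ginvK x : ginv (ginv x) = x.
Proof. apply (gmul_cancel_l (ginv x)). now rewrite gmulVr, gmulVl. Qed.

Lemma ginv1 : ginv (gone : G) = gone.
Proof. rewrite <- (gmul1l G (ginv gone)). apply gmulVr. Qed.

Lemma ginvM x y : ginv (gmul x y) = gmul (ginv y) (ginv x).
Proof.
  apply (gmul_cancel_l (gmul x y)).
  rewrite gmulVr, <- gmulA, gmulKr, gmulVr. reflexivity.
Qed.

Lemma gmulAr x y z : gmul (gmul x y) z = gmul x (gmul y z).
Proof. symmetry; apply gmulA. Qed.

Lemma gprod_app (l1 l2 : list G) :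
  gprod G (l1 ++ l2) = gmul (gprod G l1) (gprod G l2).
Proof.
  induction l1 as [|x l IH]; simpl; [now rewrite gmul1l|].
  now rewrite IH, gmulA.
Qed.

Fixpoint gpow x (n : nat) : G :=
  match n with O => gone | S n' => gmul x (gpow x n') end.

Lemma gpow_add x m n : gpow x (m + n) = gmul (gpow x m) (gpow x n).
Proof.
  induction m as [|m IH]; simpl; [now rewrite gmul1l|]. now rewrite IH, gmulA.
Qed.

Lemma gpow_S_r x n : gpow x (S n) = gmul (gpow x n) x.
Proof. rewrite <- Nat.add_1_r, gpow_add. simpl. now rewrite gmul1r. Qed.

Lemma gpow_inv x n : gpow (ginv x) n = ginv (gpow x n).
Proof.
  induction n as [|n IH]; simpl; [now rewrite ginv1|].
  now rewrite IH, <- ginvM, <- gpow_S_r.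
Qed.

Lemma gpow_gone n : gpow gone n = gone.
Proof. induction n as [|n IH]; simpl; [reflexivity|]. now rewrite IH, gmul1l. Qed.

Lemma gpow_conj x y n :
  gpow (gmul (gmul y x) (ginv y)) n = gmul (gmul y (gpow x n)) (ginv y).
Proof.
  induction n as [|n IH]; simpl; [now rewrite gmul1r, gmulVr|].
  rewrite IH, !gmulAr. now rewrite gmulKl.
Qed.

Lemma gprod_repeat x n : gprod G (repeat x n) = gpow x n.
Proof. induction n as [|n IH]; simpl; [reflexivity|]. now rewrite IH. Qed.

End GroupFacts.
Arguments gpow {G}.

Hint Rewrite gmulAr gmul1l gmul1r gmulVl gmulVr gmulKl gmulKr ginvK ginv1 ginvM : grp.
Ltac grp := autorewrite with grp; try reflexivity.

(** * Formal commutators and the combinatorics of collection *)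

Inductive tree := Leaf (l : nat * bool) | Node (t1 t2 : tree).

Lemma tree_eq_dec (s t : tree) : {s = t} + {s <> t}.
Proof. decide equality. destruct l as [i b], l0 as [j c]. decide equality.
  apply Bool.bool_dec. apply Nat.eq_dec. Defined.

Notation cnt s w := (count_occ tree_eq_dec w s).

Fixpoint tweight (t : tree) : nat :=
  match t with Leaf _ => 1 | Node a b => tweight a + tweight b end.

Lemma tweight_pos t : 1 <= tweight t.
Proof. induction t; simpl; lia. Qed.

(* Moving a letter [t] to the left through a word [w] of commutators: [w t = t (push t w)],
   because [y t = t y [y, t]] for each letter [y]. *)
Definition push (t : tree) (w : list tree) : list tree :=
  flat_map (fun y => [y; Node y t]) w.

(** Formal conjugation: [pushes v u] is a word for v^-1 u v. *)
Definition pushes (v u : list tree) : list tree :=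
  fold_left (fun acc y => push y acc) v u.

Lemma push_app t u1 u2 : push t (u1 ++ u2) = push t u1 ++ push t u2.
Proof. apply flat_map_app. Qed.

Lemma pushes_app v : forall u1 u2, pushes v (u1 ++ u2) = pushes v u1 ++ pushes v u2.
Proof.
  induction v as [|z v IH]; intros u1 u2; simpl; [reflexivity|].
  now rewrite push_app, IH.
Qed.

Lemma pushes_nil v : pushes v [] = [].
Proof. induction v; simpl; auto. Qed.

Definition cnt_step (s t : tree) (w : list tree) : nat :=
  match s with
  | Leaf _ => 0
  | Node y t' => if tree_eq_dec t t' then cnt y w else 0
  end.

Lemma cnt_push s t w : cnt s (push t w) = cnt s w + cnt_step s t w.
Proof.
  induction w as [|y w IH].
  - destruct s as [|s1 s2]; simpl; [reflexivity|]. destruct (tree_eq_dec t s2); reflexivity.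
  - change (push t (y :: w)) with (y :: Node y t :: push t w).
    destruct s as [l|s1 s2]; cbn [count_occ cnt_step] in *.
    + destruct (tree_eq_dec (Node y t) (Leaf l)); [discriminate|].
      destruct (tree_eq_dec y (Leaf l)); lia.
    + destruct (tree_eq_dec (Node y t) (Node s1 s2)) as [E|E];
      destruct (tree_eq_dec y (Node s1 s2));
      destruct (tree_eq_dec y s1); destruct (tree_eq_dec t s2);
      try (exfalso; congruence); lia.
Qed.

Definition dominated (u w : list tree) : Prop := forall s, cnt s u <= cnt s w.

Lemma push_mono t u w : dominated u w -> dominated (push t u) (push t w).
Proof.
  intros D s. rewrite !cnt_push. apply Nat.add_le_mono; [apply D|].
  destruct s as [|s1 s2]; simpl; [lia|]. destruct (tree_eq_dec t s2); [apply D|lia].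
Qed.

Lemma push_dominates t w : dominated w (push t w).
Proof. intros s. rewrite cnt_push. lia. Qed.

Lemma pushes_mono v : forall u w, dominated u w -> dominated (pushes v u) (pushes v w).
Proof. induction v as [|z v IH]; simpl; intros u w D; [exact D|]. now apply IH, push_mono. Qed.

Lemma pushes_dominates v : forall u, dominated u (pushes v u).
Proof.
  induction v as [|z v IH]; simpl; intros u s; [lia|].
  eapply Nat.le_trans; [apply (push_dominates z)|apply IH].
Qed.

Lemma cnt_pushes_Leaf l v : forall u, cnt (Leaf l) (pushes v u) = cnt (Leaf l) u.
Proof.
  induction v as [|z v IH]; simpl; intros u; [reflexivity|].
  rewrite IH, cnt_push. simpl; lia.
Qed.

(** Each letter [t] of [v] creates one [Node y t] for every [y] it crosses. Copies of [y] never
    disappear, so their final number bounds every such contribution. *)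
Lemma cnt_pushes_Node y t v : forall u,
  cnt (Node y t) (pushes v u) <= cnt (Node y t) u + cnt t v * cnt y (pushes v u).
Proof.
  induction v as [|z v IH]; intros u; [simpl; lia|].
  change (pushes (z :: v) u) with (pushes v (push z u)).
  specialize (IH (push z u)). rewrite cnt_push in IH. unfold cnt_step in IH.
  assert (cnt y u <= cnt y (pushes v (push z u))).
  { eapply Nat.le_trans; [apply (push_dominates z)|apply pushes_dominates]. }
  cbn [count_occ]. destruct (tree_eq_dec z t); lia.
Qed.

(** A letter and its inverse are different leaves, which keeps all exponents natural numbers, but
    both count towards the same degree; hence only [fst l] matters. *)
Fixpoint mon (a : nat -> nat) (t : tree) : nat :=
  match t with Leaf l => a (fst l) | Node t1 t2 => mon a t1 * mon a t2 end.

(* The constants may depend on the tree but not on the degrees [a]. *)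
Definition bounded (K : tree -> nat) (a : nat -> nat) (w : list tree) : Prop :=
  forall s, cnt s w <= K s * mon a s.

Lemma bounded_dominated K a u w : dominated u w -> bounded K a w -> bounded K a u.
Proof. intros D B s. eapply Nat.le_trans; [apply D|apply B]. Qed.

Lemma bounded_app K1 K2 a u w :
  bounded K1 a u -> bounded K2 a w -> bounded (fun s => K1 s + K2 s) a (u ++ w).
Proof. intros B1 B2 s. rewrite count_occ_app. specialize (B1 s); specialize (B2 s). nia. Qed.

Fixpoint pushes_const (Ku Kv : tree -> nat) (s : tree) : nat :=
  match s with
  | Leaf l => Ku (Leaf l)
  | Node y t => Ku (Node y t) + Kv t * pushes_const Ku Kv y
  end.

(** Induction on the tree along [cnt_pushes_Node]: the bounds for [y] and [t] multiply exactly as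
    their monomials do. *)
Lemma bounded_pushes Ku Kv a u v :
  bounded Ku a u -> bounded Kv a v -> bounded (pushes_const Ku Kv) a (pushes v u).
Proof.
  intros Bu Bv s. induction s as [l|y IHy t _].
  - rewrite cnt_pushes_Leaf. apply Bu.
  - eapply Nat.le_trans; [apply cnt_pushes_Node|].
    simpl. specialize (Bu (Node y t)). specialize (Bv t). simpl in Bu.
    rewrite Nat.mul_add_distr_r. apply Nat.add_le_mono; [exact Bu|].
    eapply Nat.le_trans; [apply (Nat.mul_le_mono _ _ _ _ Bv IHy)|]. nia.
Qed.

Lemma bounded_repeat a t q : q <= mon a t -> bounded (fun _ => 1) a (repeat t q).
Proof.
  intros L s. destruct (tree_eq_dec t s) as [->|E].
  - rewrite count_occ_repeat_eq by reflexivity. lia.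
  - rewrite count_occ_repeat_neq by auto. lia.
Qed.

Lemma cnt_pos s w : In s w <-> 0 < cnt s w.
Proof. rewrite (count_occ_In tree_eq_dec). lia. Qed.

Definition minweight (k : nat) (w : list tree) : Prop := forall s, In s w -> k <= tweight s.

Lemma minweight_app k u w : minweight k (u ++ w) <-> minweight k u /\ minweight k w.
Proof.
  unfold minweight. split.
  - intros M; split; intros s I; apply M, in_or_app; auto.
  - intros [M1 M2] s I. apply in_app_or in I as [I|I]; auto.
Qed.

Lemma minweight_le k k' w : k' <= k -> minweight k w -> minweight k' w.
Proof. intros L M s I. specialize (M s I). lia. Qed.

Lemma in_push s t w : In s (push t w) -> In s w \/ exists y, In y w /\ s = Node y t.
Proof.
  unfold push. rewrite in_flat_map. intros [y [Iy [E|[E|[]]]]]; subst; eauto.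
Qed.

Lemma minweight_pushes k v : forall u, minweight k u -> minweight k (pushes v u).
Proof.
  induction v as [|z v IH]; simpl; intros u M; [exact M|].
  apply IH. intros s I. apply in_push in I as [I|[y [I ->]]]; [now apply M|].
  specialize (M y I). simpl. lia.
Qed.

Lemma in_pushes_repeat t n : forall s u,
  In s (pushes (repeat t n) u) -> In s u \/ tweight t < tweight s.
Proof.
  induction n as [|n IH]; simpl; intros s u I; [auto|].
  apply IH in I as [I|I]; [|auto].
  apply in_push in I as [I|[y [I ->]]]; [auto|].
  right. simpl. pose proof (tweight_pos y). lia.
Qed.

(** Every letter created by crossing a word of weights at least [k] weighs more than [k], so
    multiplicities up to weight [k] stay unchanged. *)
Lemma cnt_pushes_low k s v : forall u,
  minweight k u -> tweight s <= k -> cnt s (pushes v u) = cnt s u.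
Proof.
  induction v as [|z v IH]; simpl; intros u M L; [reflexivity|].
  rewrite IH; [|apply (minweight_pushes k [z]); exact M|exact L].
  rewrite cnt_push. destruct s as [|y t]; simpl; [lia|].
  destruct (tree_eq_dec z t); [|lia].
  destruct (cnt y u) eqn:E; [lia|exfalso].
  assert (I : In y u) by (apply cnt_pos; lia).
  specialize (M y I). simpl in L. pose proof (tweight_pos t). lia.
Qed.

(** What remains of [w] once all copies of [t] stand in front: a letter is crossed by precisely the
    copies of [t] to its right. *)
Fixpoint collect (t : tree) (w : list tree) : list tree :=
  match w with
  | [] => []
  | x :: w' => if tree_eq_dec x t then collect t w'
               else pushes (repeat t (cnt t w')) [x] ++ collect t w'
  end.

Lemma pushes_repeat_mono t n u w :
  dominated u w -> dominated (pushes (repeat t n) u) (pushes (repeat t (S n)) w).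
Proof.
  intros D. simpl. apply pushes_mono. intros s.
  eapply Nat.le_trans; [apply D|apply push_dominates].
Qed.

Lemma collect_dominated t w : dominated (collect t w) (pushes (repeat t (cnt t w)) w).
Proof.
  induction w as [|x w IH]; intros s; simpl; [lia|].
  destruct (tree_eq_dec x t) as [->|E].
  - eapply Nat.le_trans; [apply IH|]. apply pushes_repeat_mono.
    intros s'. simpl. destruct (tree_eq_dec t s'); lia.
  - change (x :: w) with ([x] ++ w). rewrite pushes_app, !count_occ_app.
    specialize (IH s). lia.
Qed.

Lemma in_collect s t w :
  In s (collect t w) -> (In s w /\ s <> t) \/ tweight t < tweight s.
Proof.
  induction w as [|x w IH]; simpl; [easy|].
  destruct (tree_eq_dec x t) as [->|E]; intros I.
  - destruct (IH I) as [[H1 H2]|H1]; auto.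
  - apply in_app_or in I as [I|I].
    + apply in_pushes_repeat in I as [[->|[]]|I]; auto.
    + destruct (IH I) as [[H1 H2]|H1]; auto.
Qed.

Definition collect_const (K : tree -> nat) (t : tree) : tree -> nat :=
  pushes_const K (fun s => if tree_eq_dec t s then K t else 0).

Lemma bounded_collect K a t w : bounded K a w -> bounded (collect_const K t) a (collect t w).
Proof.
  intros B. eapply bounded_dominated; [apply collect_dominated|].
  apply bounded_pushes; [exact B|]. intros s.
  destruct (tree_eq_dec t s) as [->|E].
  - rewrite count_occ_repeat_eq by reflexivity. apply B.
  - rewrite count_occ_repeat_neq by auto. lia.
Qed.

Fixpoint letter_comm (v : list tree) (x : tree) : list tree :=
  match v with [] => [] | z :: v' => letter_comm v' x ++ pushes v' [Node x z] end.

Lemma pushes_single v x : pushes v [x] = x :: letter_comm v x.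
Proof.
  induction v as [|z v IH]; simpl; [reflexivity|].
  change [x; Node x z] with ([x] ++ [Node x z]).
  now rewrite pushes_app, IH.
Qed.

(* [xu, v] = [x, v]^u [u, v] and [x, zv] = [x, v] [x, z]^v. *)
Fixpoint word_comm (u v : list tree) : list tree :=
  match u with
  | [] => []
  | x :: u' => pushes u' (letter_comm v x) ++ word_comm u' v
  end.

Lemma pushes_cons v x u : pushes v (x :: u) = x :: letter_comm v x ++ pushes v u.
Proof. change (x :: u) with ([x] ++ u). now rewrite pushes_app, pushes_single. Qed.

(** The letters of [letter_comm v x] already occur in [pushes v u]; in the commutator they are
    crossed by the rest of [u], which the outer [pushes u] overestimates. *)
Lemma word_comm_dominated u v : dominated (word_comm u v) (pushes u (pushes v u)).
Proof.
  induction u as [|x u IH]; intros s; [simpl; lia|].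
  rewrite pushes_cons.
  change (pushes (x :: u) ?w) with (pushes u (push x w)).
  eapply Nat.le_trans; [|apply (pushes_mono u _ _ (push_dominates x _))].
  change (x :: letter_comm v x ++ pushes v u)
    with ([x] ++ letter_comm v x ++ pushes v u).
  cbn [word_comm]. rewrite !pushes_app, !count_occ_app. specialize (IH s). lia.
Qed.

Lemma minweight_letter_comm k1 k2 v x :
  k1 <= tweight x -> minweight k2 v -> minweight (k1 + k2) (letter_comm v x).
Proof.
  intros L M. induction v as [|z v IH]; simpl; [easy|].
  apply minweight_app; split.
  - apply IH. intros s I. apply M; now right.
  - apply minweight_pushes. intros s [<-|[]]. simpl. specialize (M z (or_introl eq_refl)). lia.
Qed.

Lemma minweight_word_comm k1 k2 u v :
  minweight k1 u -> minweight k2 v -> minweight (k1 + k2) (word_comm u v).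
Proof.
  intros Mu Mv. induction u as [|x u IH]; simpl; [easy|].
  apply minweight_app; split.
  - apply minweight_pushes, minweight_letter_comm; [|exact Mv]. apply Mu; now left.
  - apply IH. intros s I; apply Mu; now right.
Qed.

Lemma cnt_letter_comm_low k1 k2 s1 s2 v x :
  k1 <= tweight x -> minweight k2 v -> tweight s1 + tweight s2 <= k1 + k2 ->
  cnt (Node s1 s2) (letter_comm v x) = if tree_eq_dec x s1 then cnt s2 v else 0.
Proof.
  intros L M W. induction v as [|z v IH].
  - simpl. now destruct (tree_eq_dec x s1).
  - cbn [letter_comm]. rewrite count_occ_app, IH by (intros s I; apply M; now right).
    rewrite (cnt_pushes_low (k1 + k2)); [| |exact W].
    + cbn [count_occ].
      destruct (tree_eq_dec (Node x z) (Node s1 s2)); destruct (tree_eq_dec x s1);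
      destruct (tree_eq_dec z s2); try (exfalso; congruence); lia.
    + intros s [<-|[]]. simpl. specialize (M z (or_introl eq_refl)). lia.
Qed.

(** At lowest weight the commutator is bilinear: each pair of a copy of [s1] in [u] and a copy of
    [s2] in [v] yields one [Node s1 s2], and all further crossings create trees heavier than
    [k1 + k2]. *)
Lemma cnt_word_comm_low k1 k2 s1 s2 u v :
  minweight k1 u -> minweight k2 v -> tweight s1 + tweight s2 <= k1 + k2 ->
  cnt (Node s1 s2) (word_comm u v) = cnt s1 u * cnt s2 v.
Proof.
  intros Mu Mv W. induction u as [|x u IH]; [reflexivity|].
  assert (Lx : k1 <= tweight x) by (apply Mu; now left).
  cbn [word_comm]. rewrite count_occ_app, IH by (intros s I; apply Mu; now right).
  rewrite (cnt_pushes_low (k1 + k2));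
    [|now apply minweight_letter_comm|exact W].
  rewrite (cnt_letter_comm_low k1 k2) by assumption.
  cbn [count_occ]. destruct (tree_eq_dec x s1); lia.
Qed.

Lemma in_word_comm_low k1 k2 t1 t2 q r E1 E2 s :
  tweight t1 = k1 -> tweight t2 = k2 ->
  minweight (S k1) E1 -> minweight (S k2) E2 ->
  In s (word_comm (repeat t1 q ++ E1) (repeat t2 r ++ E2)) ->
  tweight s <= k1 + k2 -> s = Node t1 t2.
Proof.
  intros W1 W2 M1 M2 I L.
  assert (Mu : minweight k1 (repeat t1 q ++ E1)).
  { apply minweight_app; split; [|eapply minweight_le; [|exact M1]; lia].
    intros x Ix. apply repeat_spec in Ix. subst; lia. }
  assert (Mv : minweight k2 (repeat t2 r ++ E2)).
  { apply minweight_app; split; [|eapply minweight_le; [|exact M2]; lia].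
    intros x Ix. apply repeat_spec in Ix. subst; lia. }
  pose proof (minweight_word_comm _ _ _ _ Mu Mv s I) as Ls.
  pose proof (tweight_pos t1); pose proof (tweight_pos t2).
  destruct s as [l|s1 s2]; simpl in Ls, L; [lia|].
  apply cnt_pos in I. rewrite (cnt_word_comm_low k1 k2) in I by assumption.
  assert (I1 : In s1 (repeat t1 q ++ E1)) by (apply cnt_pos; nia).
  assert (I2 : In s2 (repeat t2 r ++ E2)) by (apply cnt_pos; nia).
  pose proof (Mu _ I1). pose proof (Mv _ I2).
  apply in_app_or in I1 as [I1|I1]; [|specialize (M1 _ I1); lia].
  apply in_app_or in I2 as [I2|I2]; [|specialize (M2 _ I2); lia].
  apply repeat_spec in I1; apply repeat_spec in I2. congruence.
Qed.

(** The index in the lower central series is read off from the height. This follows from the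
    definition of [lcs] alone, whereas a bound by the weight would rest on [gamma_i, gamma_j] lying
    in gamma_(i+j); the price is the exponential bound of [tweight_height]. *)
Fixpoint height (t : tree) : nat :=
  match t with Leaf _ => 0 | Node a b => S (Nat.max (height a) (height b)) end.

Lemma tweight_height t : tweight t <= 2 ^ height t.
Proof.
  induction t as [l|a IHa b IHb]; simpl; [lia|].
  assert (2 ^ height a <= 2 ^ Nat.max (height a) (height b)) by (apply Nat.pow_le_mono_r; lia).
  assert (2 ^ height b <= 2 ^ Nat.max (height a) (height b)) by (apply Nat.pow_le_mono_r; lia).
  lia.
Qed.

Lemma height_tweight t : height t < tweight t.
Proof.
  induction t as [l|a IHa b IHb]; simpl; [lia|].
  pose proof (tweight_pos a); pose proof (tweight_pos b). lia.
Qed.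

Fixpoint all_trees (n h : nat) : list tree :=
  map Leaf (list_prod (seq 0 n) [true; false]) ++
  match h with
  | O => []
  | S h' => map (fun ab => Node (fst ab) (snd ab)) (list_prod (all_trees n h') (all_trees n h'))
  end.

(** A tree with a leaf outside the alphabet has monomial 0 and cannot occur in a bounded word. So
    the trees of a given weight to be collected form a finite list that does not depend on the
    degrees. *)
Lemma in_all_trees n a : (forall i, n <= i -> a i = 0) ->
  forall h t, height t <= h -> 0 < mon a t -> In t (all_trees n h).
Proof.
  intros Ha.
  assert (HL : forall h l, 0 < a (fst l) -> In (Leaf l) (all_trees n h)).
  { intros h [i b] Hl. simpl in Hl. destruct h; apply in_or_app; left; apply in_map, in_prod;
    try (destruct b; simpl; tauto);
    apply in_seq; (destruct (le_lt_dec n i) as [L|L]; [rewrite Ha in Hl by exact L|]; lia). }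
  induction h as [|h IH]; intros [l|t1 t2] Hh Hm; try (now apply HL); simpl in Hh, Hm.
  - lia.
  - apply in_or_app; right. apply in_map_iff. exists (t1, t2); split; [reflexivity|].
    apply in_prod; apply IH; nia.
Qed.

(** * Values of formal words and products of boundedly many powers *)

Section Collection.
Variable G : group.
Variable e : nat * bool -> G.
Hypothesis e_inv : forall i b, e (i, negb b) = ginv (e (i, b)).

Fixpoint tval (t : tree) : G :=
  match t with Leaf l => e l | Node a b => gcomm G (tval a) (tval b) end.

Definition ev (w : list tree) : G := gprod G (map tval w).

Lemma ev_app u w : ev (u ++ w) = gmul (ev u) (ev w).
Proof. unfold ev. now rewrite map_app, gprod_app. Qed.

Lemma ev_repeat t n : ev (repeat t n) = gpow (tval t) n.
Proof. unfold ev. now rewrite map_repeat, gprod_repeat. Qed.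

Lemma ev_push t w : gmul (ev w) (tval t) = gmul (tval t) (ev (push t w)).
Proof.
  induction w as [|y w IH]; unfold ev in *; simpl; [now rewrite gmul1l, gmul1r|].
  rewrite gmulAr, IH. unfold gcomm. grp.
Qed.

Lemma ev_pushes v : forall u, gmul (ev u) (ev v) = gmul (ev v) (ev (pushes v u)).
Proof.
  induction v as [|z v IH]; intros u.
  - unfold ev at 2 3; simpl. grp.
  - change (ev (z :: v)) with (gmul (tval z) (ev v)). simpl (pushes _ _).
    rewrite gmulA, ev_push, !gmulAr. now rewrite IH.
Qed.

Lemma ev_collect t w : ev w = gmul (gpow (tval t) (cnt t w)) (ev (collect t w)).
Proof.
  induction w as [|x w IH]; [unfold ev; simpl; grp|].
  change (ev (x :: w)) with (gmul (tval x) (ev w)). simpl.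
  destruct (tree_eq_dec x t) as [->|E]; simpl; rewrite IH at 1.
  - now rewrite gmulA.
  - rewrite ev_app, !gmulA. f_equal.
    rewrite <- (ev_repeat t), <- ev_pushes. unfold ev at 2; simpl. grp.
Qed.

Lemma ev_word_comm u v : gcomm G (ev u) (ev v) = ev (word_comm u v).
Proof.
  (* The identity v^-1 u v = u [u, v] for words. *)
  assert (E : ev (pushes v u) = gmul (ev u) (ev (word_comm u v))).
  { induction u as [|x u IH]; [rewrite pushes_nil; unfold ev; simpl; grp|].
    rewrite pushes_cons.
    change (ev (x :: letter_comm v x ++ pushes v u))
      with (gmul (tval x) (ev (letter_comm v x ++ pushes v u))).
    rewrite ev_app, IH.
    change (ev (x :: u)) with (gmul (tval x) (ev u)).
    simpl word_comm. rewrite ev_app.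
    rewrite !gmulAr. f_equal. rewrite !gmulA. f_equal. apply ev_pushes. }
  unfold gcomm. rewrite ev_pushes. rewrite E. grp.
Qed.

Definition block_val (bl : list ((nat * bool) * nat)) : G :=
  gprod G (map (fun b => gpow (e (fst b)) (snd b)) bl).

Definition short (Q C : nat) (a : nat -> nat) (bl : list ((nat * bool) * nat)) : Prop :=
  length bl <= Q /\ forall b, In b bl -> snd b <= C * a (fst (fst b)).

Definition powers_product (Q C : nat) (a : nat -> nat) (g : G) : Prop :=
  exists bl, short Q C a bl /\ block_val bl = g.

Lemma powers_product_one a : powers_product 0 0 a gone.
Proof. exists []. split; [|reflexivity]. split; [simpl; lia|easy]. Qed.

Lemma powers_product_le Q C Q' C' a g :
  Q <= Q' -> C <= C' -> powers_product Q C a g -> powers_product Q' C' a g.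
Proof.
  intros L1 L2 [bl [[S1 S2] E]]. exists bl; split; [|exact E]. split; [lia|].
  intros b I. specialize (S2 b I). nia.
Qed.

Lemma powers_product_mul Q1 C1 Q2 C2 a g h :
  powers_product Q1 C1 a g -> powers_product Q2 C2 a h ->
  powers_product (Q1 + Q2) (C1 + C2) a (gmul g h).
Proof.
  intros [b1 [[S1 S1'] <-]] [b2 [[S2 S2'] <-]]. exists (b1 ++ b2). split; [split|].
  - rewrite length_app; lia.
  - intros b I. apply in_app_or in I as [I|I]; [specialize (S1' b I)|specialize (S2' b I)]; nia.
  - unfold block_val. now rewrite map_app, gprod_app.
Qed.

Lemma powers_product_inv Q C a g : powers_product Q C a g -> powers_product Q C a (ginv g).
Proof.
  intros [bl [[S1 S2] <-]].
  exists (rev (map (fun b => ((fst (fst b), negb (snd (fst b))), snd b)) bl)).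
  split; [split|].
  - now rewrite length_rev, length_map.
  - intros b I. apply in_rev, in_map_iff in I as [b' [<- I]]. now apply (S2 b').
  - clear S1 S2. induction bl as [|[[i c] n] bl IH]; unfold block_val in *; simpl; [grp|].
    rewrite map_app, gprod_app, IH. simpl. rewrite e_inv, gpow_inv. grp.
Qed.

Lemma powers_product_comm Q1 C1 Q2 C2 a g h :
  powers_product Q1 C1 a g -> powers_product Q2 C2 a h ->
  powers_product (2 * Q1 + 2 * Q2) (2 * C1 + 2 * C2) a (gcomm G g h).
Proof.
  intros Pg Ph. unfold gcomm.
  pose proof (powers_product_inv _ _ _ _ Pg) as Pg'.
  pose proof (powers_product_inv _ _ _ _ Ph) as Ph'.
  pose proof (powers_product_mul _ _ _ _ _ _ _
    (powers_product_mul _ _ _ _ _ _ _ Pg' Ph') (powers_product_mul _ _ _ _ _ _ _ Pg Ph)) as X.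
  revert X. apply powers_product_le; lia.
Qed.

(** Powers of a tree are controlled only up to its monomial, while collection yields up to a
    constant multiple [j] of it; the exponent is cut into [j] pieces. *)
Lemma powers_product_pow Q C a x m j : forall n,
  (forall p, p <= m -> powers_product Q C a (gpow x p)) -> n <= j * m ->
  powers_product (j * Q) (j * C) a (gpow x n).
Proof.
  induction j as [|j IH]; intros n P L.
  - replace n with 0 by lia. apply powers_product_one.
  - replace n with (Nat.min n m + (n - Nat.min n m)) by lia. rewrite gpow_add.
    apply powers_product_mul; [apply P; lia|apply IH; [exact P|lia]].
Qed.

(* Up to heavier commutators, [t^p] with [p <= mon a t] is obtained from commutators of powers:
   for [p = q * m2 + r] one takes [t1^q, t2^m2] [t1, t2^r]. *)
Lemma tree_power_approx t : exists Q C K, forall a p, p <= mon a t ->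
  exists g E, powers_product Q C a g /\ g = gmul (gpow (tval t) p) (ev E) /\
    bounded K a E /\ minweight (S (tweight t)) E.
Proof.
  induction t as [l|t1 [Q1 [C1 [K1 IH1]]] t2 [Q2 [C2 [K2 IH2]]]].
  - exists 1, 1, (fun _ => 0). intros a p L. exists (gpow (e l) p), []. split; [|split; [|split]].
    + exists [(l, p)]. split; [split; [simpl; lia|]|].
      * intros b [<-|[]]. simpl in *. lia.
      * unfold block_val; simpl. grp.
    + unfold ev; simpl. grp.
    + intros s; simpl; lia.
    + easy.
  - set (t := Node t1 t2).
    set (Ku := fun s => 1 + K1 s). set (Kv := fun s => 1 + K2 s).
    set (Kc := pushes_const (pushes_const Ku Kv) Ku).
    assert (Step : forall a q r, q <= mon a t1 -> r <= mon a t2 -> exists g w,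
      powers_product (2 * Q1 + 2 * Q2) (2 * C1 + 2 * C2) a g /\ g = ev w /\ bounded Kc a w /\
      cnt t w = q * r /\ forall s, In s w -> s = t \/ tweight t < tweight s).
    { intros a q r Lq Lr.
      destruct (IH1 a q Lq) as [g1 [E1 [P1 [Eq1 [B1 M1]]]]].
      destruct (IH2 a r Lr) as [g2 [E2 [P2 [Eq2 [B2 M2]]]]].
      set (u := repeat t1 q ++ E1). set (v := repeat t2 r ++ E2).
      assert (Bu : bounded Ku a u) by (apply bounded_app; [now apply bounded_repeat|exact B1]).
      assert (Bv : bounded Kv a v) by (apply bounded_app; [now apply bounded_repeat|exact B2]).
      assert (Mu : minweight (tweight t1) u).
      { apply minweight_app; split; [|eapply minweight_le; [|exact M1]; lia].
        intros x Ix. apply repeat_spec in Ix. subst; lia. }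
      assert (Mv : minweight (tweight t2) v).
      { apply minweight_app; split; [|eapply minweight_le; [|exact M2]; lia].
        intros x Ix. apply repeat_spec in Ix. subst; lia. }
      assert (low : forall s E, minweight (S (tweight s)) E -> cnt s E = 0).
      { intros s E M. destruct (cnt s E) eqn:Eq; [reflexivity|].
        assert (I : In s E) by (apply cnt_pos; lia). specialize (M s I). lia. }
      exists (gcomm G g1 g2), (word_comm u v). split; [now apply powers_product_comm|].
      split; [|split; [|split]].
      - rewrite <- ev_word_comm. unfold u, v. now rewrite !ev_app, !ev_repeat, <- Eq1, <- Eq2.
      - eapply bounded_dominated; [apply word_comm_dominated|].
        apply bounded_pushes; [now apply bounded_pushes|exact Bu].
      (* [E1] and [E2] are heavier than [t1] and [t2], so bilinearity leaves exactly [q * r] copies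
         of [t]. *)
      - unfold t. rewrite (cnt_word_comm_low (tweight t1) (tweight t2)) by (assumption || lia).
        unfold u, v. rewrite !count_occ_app, !count_occ_repeat_eq by reflexivity.
        rewrite (low t1 E1 M1), (low t2 E2 M2). lia.
      - intros s I. destruct (le_lt_dec (tweight s) (tweight t)) as [L|L]; [|now right].
        left. apply (in_word_comm_low _ _ t1 t2 q r E1 E2 s eq_refl eq_refl M1 M2 I L). }
    exists (2 * (2 * Q1 + 2 * Q2)), (2 * (2 * C1 + 2 * C2)),
      (collect_const (fun s => Kc s + Kc s) t).
    intros a p L. simpl in L.
    assert (HD : exists q1 r1 q2 r2, q1 <= mon a t1 /\ r1 <= mon a t2 /\ q2 <= mon a t1 /\
      r2 <= mon a t2 /\ p = q1 * r1 + q2 * r2).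
    (* Degrees may vanish. For [p > 0] both monomials are positive, as required for the division by
       [mon a t2] and for the exponent 1 of [t1]. *)
    { destruct (Nat.eq_dec p 0) as [->|Hp]; [exists 0, 0, 0, 0; lia|].
      assert (H1 : mon a t1 <> 0) by (intros Z; rewrite Z in L; lia).
      assert (H2 : mon a t2 <> 0) by (intros Z; rewrite Z in L; lia).
      exists (p / mon a t2), (mon a t2), 1, (p mod mon a t2).
      pose proof (Nat.div_mod p _ H2). pose proof (Nat.mod_upper_bound p _ H2).
      assert (p / mon a t2 <= mon a t1); [|lia].
      apply Nat.Div0.div_le_upper_bound. lia. }
    destruct HD as [q1 [r1 [q2 [r2 [L1 [L2 [L3 [L4 Ep]]]]]]]].
    destruct (Step a q1 r1 L1 L2) as [g [w [P [Eg [B [Cw Iw]]]]]].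
    destruct (Step a q2 r2 L3 L4) as [g' [w' [P' [Eg' [B' [Cw' Iw']]]]]].
    exists (gmul g g'), (collect t (w ++ w')). split; [|split; [|split]].
    + pose proof (powers_product_mul _ _ _ _ _ _ _ P P') as X. revert X.
      apply powers_product_le; lia.
    + rewrite Eg, Eg', <- ev_app, (ev_collect t).
      rewrite count_occ_app, Cw, Cw', Ep. reflexivity.
    + apply bounded_collect, bounded_app; assumption.
    + intros s I. apply in_collect in I as [[I N]|I]; [|lia].
      apply in_app_or in I as [I|I]; [destruct (Iw s I)|destruct (Iw' s I)];
      try (exfalso; auto; fail); lia.
Qed.

Variables (M n : nat).
Hypothesis tval_heavy : forall t, M < tweight t -> tval t = gone.

(** [j] counts the weights from [k] to [M] that remain. A power of a tree of weight [k] is a product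
    of powers of letters times the inverse of an error of weight at least [k + 1], which the
    induction hypothesis handles; it also handles the word left after collecting all trees of weight
    [k]. *)
Lemma bounded_word_powers j : forall k, k + j = S M -> forall K, exists Q C, forall a w,
  (forall i, n <= i -> a i = 0) -> bounded K a w -> minweight k w ->
  powers_product Q C a (ev w).
Proof.
  induction j as [|j IHj]; intros k Hk K.
  - exists 0, 0. intros a w _ _ Mw. replace (ev w) with (gone : G); [apply powers_product_one|].
    symmetry. induction w as [|x w IH]; [reflexivity|].
    change (ev (x :: w)) with (gmul (tval x) (ev w)).
    rewrite tval_heavy, IH, gmul1l; [reflexivity| |].
    + intros s I; apply Mw; now right.
    + specialize (Mw x (or_introl eq_refl)). lia.
  - assert (Pow : forall t, tweight t = k -> exists Q C, forall a p,
        (forall i, n <= i -> a i = 0) -> p <= mon a t -> powers_product Q C a (gpow (tval t) p)).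
    { intros t Ht. destruct (tree_power_approx t) as [Q [C [K' X]]].
      destruct (IHj (S k) ltac:(lia) K') as [Q' [C' Y]].
      exists (Q + Q'), (C + C'). intros a p Ha L.
      destruct (X a p L) as [g [E [P [Eg [B Mi]]]]]. rewrite Ht in Mi.
      replace (gpow (tval t) p) with (gmul g (ginv (ev E))) by (rewrite Eg; grp).
      apply powers_product_mul; [exact P|]. apply powers_product_inv, Y; assumption. }
    (* The trees of weight [k] are removed one by one. Collecting one of them creates only heavier
       trees, so none of those already removed returns. *)
    assert (Coll : forall L, (forall t, In t L -> tweight t = k) -> forall K, exists Q C K',
      forall a w, (forall i, n <= i -> a i = 0) -> bounded K a w -> minweight k w ->
      exists g w', powers_product Q C a g /\ ev w = gmul g (ev w') /\ bounded K' a w' /\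
        minweight k w' /\ forall s, In s w' -> tweight s = k -> In s w /\ ~ In s L).
    { induction L as [|t L IHL]; intros HL K0.
      - exists 0, 0, K0. intros a w Ha B Mi. exists gone, w.
        repeat split; try assumption; [apply powers_product_one|grp|easy].
      - destruct (IHL ltac:(intros s I; apply HL; now right) (collect_const K0 t))
          as [Q [C [K' X]]].
        assert (Ht : tweight t = k) by (apply HL; now left).
        destruct (Pow t Ht) as [Q1 [C1 Y]].
        exists (K0 t * Q1 + Q), (K0 t * C1 + C), K'. intros a w Ha B Mi.
        assert (Mc : minweight k (collect t w)).
        { intros s I. apply in_collect in I as [[I _]|I]; [now apply Mi|lia]. }
        destruct (X a (collect t w) Ha (bounded_collect _ _ _ _ B) Mc)
          as [g [w' [P [E [B' [M' I']]]]]].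
        exists (gmul (gpow (tval t) (cnt t w)) g), w'. split; [|split; [|split; [|split]]].
        + apply powers_product_mul; [|exact P].
          apply powers_product_pow with (m := mon a t); [|apply B]. intros p Lp. now apply Y.
        + rewrite (ev_collect t w), E. grp.
        + exact B'.
        + exact M'.
        + intros s I Hs. destruct (I' s I Hs) as [I1 I2].
          apply in_collect in I1 as [[I1 N]|I1]; [|lia].
          split; [exact I1|]. intros [->|I3]; auto. }
    set (L := filter (fun t => Nat.eqb (tweight t) k) (all_trees n k)).
    assert (HL : forall t, In t L -> tweight t = k).
    { intros t I. apply filter_In in I as [_ I]. now apply Nat.eqb_eq. }
    destruct (Coll L HL K) as [Q [C [K' X]]].
    destruct (IHj (S k) ltac:(lia) K') as [Q' [C' Y]].
    exists (Q + Q'), (C + C'). intros a w Ha B Mi.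
    destruct (X a w Ha B Mi) as [g [w' [P [E [B' [M' I']]]]]].
    rewrite E. apply powers_product_mul; [exact P|]. apply Y; [exact Ha|exact B'|].
    intros s I. specialize (M' s I). destruct (Nat.eq_dec (tweight s) k) as [Es|]; [|lia].
    (* A surviving tree of weight [k] has a positive count, hence a positive monomial, hence lies in
       [L], all of which was removed. *)
    exfalso. destruct (I' s I Es) as [_ N]. apply N, filter_In.
    split; [|now apply Nat.eqb_eq]. apply (in_all_trees n a Ha).
    + pose proof (height_tweight s). lia.
    + apply cnt_pos in I. specialize (B' s). nia.
Qed.

End Collection.

(** * Vanishing of heavy commutators and the word theorem *)

Lemma tval_in_lcs (G : group) (e : nat * bool -> G) (N : G -> Prop) :
  is_subgroup G N -> (forall l, N (e l)) ->
  forall t, N (tval G e t) /\ lcs G N (height t) (tval G e t).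
Proof.
  intros [N1 [NM NV]] He.
  induction t as [l|t1 [IN1 IL1] t2 [IN2 IL2]]; simpl; [auto|].
  split; [unfold gcomm; auto 10|].
  exists [gcomm G (tval G e t1) (tval G e t2)]. split; [|simpl; grp].
  constructor; [|constructor].
  destruct (Nat.max_spec (height t1) (height t2)) as [[L E]|[L E]]; rewrite E.
  (* If the right subtree is the higher one, the generator is the inverse commutator [y, x];
     [gen_by] admits inverses of generators. *)
  - right. exists (tval G e t2), (tval G e t1). repeat split; auto. unfold gcomm. grp.
  - left. exists (tval G e t1), (tval G e t2). auto.
Qed.

Lemma lcs_trivial_from (G : group) (N : G -> Prop) c :
  (forall z, lcs G N c z -> z = gone) -> forall d z, lcs G N (d + c) z -> z = gone.
Proof.
  intros Hc. induction d as [|d IH]; simpl; [exact Hc|].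
  intros z [l [F <-]]. induction F as [|a l Ha F IHl]; simpl; [reflexivity|].
  rewrite IHl, gmul1r.
  assert (X : forall b, (exists x y, lcs G N (d + c) x /\ N y /\ b = gcomm G x y) -> b = gone).
  { intros b [x [y [Hx [_ ->]]]]. rewrite (IH x Hx). unfold gcomm. grp. }
  destruct Ha as [Ha|Ha]; apply X in Ha; [exact Ha|].
  now rewrite <- (ginvK G a), Ha, ginv1.
Qed.

(** A word consists of trees of weight 1, each occurring at most as often as its degree, so
    collection starts with [K = 1]. It stops at weight [2 ^ c]: a heavier tree has height above [c]
    and trivial value. *)
Theorem nilpotent_word_powers (G : group) (N : G -> Prop) (Sigma : list G) :
  is_subgroup G N -> is_nilpotent G N -> (forall s, In s Sigma -> N s) ->
  exists Q C, forall w, Forall (fun l => fst l < length Sigma) w ->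
    powers_product G (letter_val G Sigma) Q C (fun i => deg i w) (word_eval G Sigma w).
Proof.
  intros HN [c Hc] HS. set (e := letter_val G Sigma).
  assert (He : forall l, N (e l)).
  { destruct HN as [N1 [_ NV]].
    assert (Hn : forall i, N (nth i Sigma gone)).
    { intros i. destruct (nth_in_or_default i Sigma gone) as [I| ->]; auto. }
    intros [i []]; unfold e, letter_val; simpl; auto. }
  assert (Hinv : forall i b, e (i, negb b) = ginv (e (i, b))).
  { intros i []; unfold e, letter_val; simpl; grp. }
  assert (Hheavy : forall t, 2 ^ c < tweight t -> tval G e t = gone).
  { intros t L. pose proof (tweight_height t) as L'.
    assert (c < height t) by (apply (Nat.pow_lt_mono_r_iff 2); lia).
    apply (lcs_trivial_from G N c Hc (height t - c)).
    replace (height t - c + c) with (height t) by lia.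
    now apply tval_in_lcs. }
  destruct (bounded_word_powers G e Hinv (2 ^ c) (length Sigma) Hheavy (2 ^ c) 1 eq_refl
    (fun _ => 1)) as [Q [C X]].
  exists Q, C. intros w Hw.
  replace (word_eval G Sigma w) with (ev G e (map Leaf w)).
  2: { unfold ev, word_eval. now rewrite map_map. }
  apply X.
  - intros i L. unfold deg. induction Hw as [|x w Hx Hw IH]; [reflexivity|].
    simpl. destruct (Nat.eqb_spec (fst x) i); [lia|exact IH].
  - intros s. rewrite Nat.mul_1_l. clear Hw. induction w as [|x w IH]; [simpl; lia|].
    destruct s as [l|s1 s2]; cbn [map count_occ] in *.
    + unfold mon, deg in *. simpl filter.
      destruct (tree_eq_dec (Leaf x) (Leaf l)) as [E|E].
      * injection E as ->. rewrite Nat.eqb_refl. simpl. lia.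
      * destruct (fst x =? fst l); simpl; lia.
    + destruct (tree_eq_dec (Leaf x) (Node s1 s2)); [discriminate|].
      replace (cnt (Node s1 s2) (map Leaf w)) with 0; [lia|].
      symmetry. apply count_occ_not_In. rewrite in_map_iff. intros [y [E _]]. discriminate.
  - intros s I. apply in_map_iff in I as [l [<- _]]. simpl; lia.
Qed.

Close Scope nat_scope.

(** * The functions Phi *)

Definition antitone_on (g : R -> R) (a b : R) : Prop :=
  forall x y, a <= x -> x <= y -> y <= b -> g y <= g x.

(** [s] is the supremum of the points where [g] exceeds [L]. As [g] may jump there, nothing is
    claimed at [s] itself, which integrals do not see. *)
Lemma antitone_level (g : R -> R) (a b L : R) : a <= b -> antitone_on g a b ->
  exists s, a <= s <= b /\ (forall x, a < x < s -> L < g x) /\ (forall x, s < x < b -> g x <= L).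
Proof.
  intros Hab Hg.
  destruct (completeness (fun x => x = a \/ (a <= x <= b /\ L < g x))) as [s [Hs1 Hs2]].
  - exists b. intros x [->|[[_ H] _]]; lra.
  - exists a. now left.
  - assert (a <= s) by (apply Hs1; now left).
    assert (s <= b) by (apply Hs2; intros x [->|[[_ ?] _]]; lra).
    exists s. split; [lra|]. split; intros x Hx.
    + apply NNPP. intros N. assert (s <= x); [|lra]. apply Hs2.
      intros y [->|[Hy1 Hy2]]; [lra|]. destruct (Rle_lt_dec y x) as [|Hxy]; [lra|].
      exfalso. apply N. apply Rlt_le_trans with (1 := Hy2). apply Hg; lra.
    + apply Rnot_lt_le. intros N. assert (x <= s); [|lra]. apply Hs1. right. lra.
Qed.

(** Truncating [g] at the level [L] below the top one removes one step of height [eps]. The part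
    above [L] is an initial interval, on which [h] takes the value [L]; elsewhere the approximant of
    the truncation serves. *)
Lemma antitone_step_approx (c : R -> R) (a b m eps : R) (n : nat) :
  a <= b -> (forall x, continuous c x) -> 0 <= eps -> forall g, antitone_on g a b ->
  (forall x, a <= x <= b -> m <= g x <= m + INR n * eps) ->
  exists h, (forall x, a <= x <= b -> h x <= g x <= h x + eps) /\
    ex_RInt (fun x => c x * h x) a b.
Proof.
  intros Hab Hc He. induction n as [|n IH]; intros g Hg Hb.
  - exists (fun _ => m). split.
    + intros x Hx. specialize (Hb x Hx). simpl in Hb. lra.
    + apply (ex_RInt_continuous (V := R_CompleteNormedModule)). intros z _.
      apply (continuous_mult c (fun _ => m)); [apply Hc|apply continuous_const].
  - set (L := m + INR n * eps).
    destruct (IH (fun x => Rmin (g x) L)) as [h [Hh Hi]].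
    + intros x y H1 H2 H3. apply Rle_min_compat_r. now apply Hg.
    + intros x Hx. specialize (Hb x Hx). fold L.
      assert (m <= L). { unfold L. pose proof (pos_INR n). nra. }
      split; [apply Rmin_glb; lra|apply Rmin_r].
    + destruct (antitone_level g a b L Hab Hg) as [s [Hs [H1 H2]]].
      exists (fun x => if Rlt_dec L (g x) then L else h x). split.
      * intros x Hx. destruct (Rlt_dec L (g x)) as [D|D].
        -- specialize (Hb x Hx). rewrite S_INR in Hb. unfold L in *. lra.
        -- specialize (Hh x Hx). rewrite Rmin_left in Hh by lra. lra.
      * apply (ex_RInt_Chasles _ a s b).
        -- apply (ex_RInt_ext (fun x => c x * L)).
           ++ intros x. rewrite Rmin_left, Rmax_right by lra. intros Hx.
              destruct (Rlt_dec L (g x)) as [D|D]; [reflexivity|].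
              exfalso. apply D, H1, Hx.
           ++ apply (ex_RInt_continuous (V := R_CompleteNormedModule)). intros z _.
              apply (continuous_mult c (fun _ => L)); [apply Hc|apply continuous_const].
        -- apply (ex_RInt_ext (fun x => c x * h x)).
           ++ intros x. rewrite Rmin_left, Rmax_right by lra. intros Hx.
              destruct (Rlt_dec L (g x)) as [D|D]; [|reflexivity].
              specialize (H2 x Hx). lra.
           ++ apply (ex_RInt_Chasles_2 (V := R_CompleteNormedModule) _ a); [lra|exact Hi].
Qed.

(** Needed for the density 2s/phi(s), where phi is monotone but possibly discontinuous: without
    integrability, [integral0] would be an unspecified value. The product is a uniform limit of
    integrable step approximations. *)
Lemma ex_RInt_mult_antitone (c g : R -> R) (a b : R) :
  a <= b -> (forall x, continuous c x) -> antitone_on g a b ->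
  ex_RInt (fun x => c x * g x) a b.
Proof.
  intros Hab Hc Hg.
  destruct (ex_RInt_ub (V := R_NormedModule) c a b) as [B HB].
  { apply (ex_RInt_continuous (V := R_CompleteNormedModule)). intros z _. apply Hc. }
  rewrite Rmin_left, Rmax_right in HB by lra.
  assert (HB0 : 0 <= B).
  { eapply Rle_trans; [apply (norm_ge_0 (V := R_NormedModule))|apply (HB a); lra]. }
  set (D := g a - g b).
  assert (HD : 0 <= D). { unfold D. specialize (Hg a b). lra. }
  assert (Hex : forall n : nat, exists f : R -> R,
    (forall x, Rabs (f x - c x * g x) <= B * (D / INR (S n))) /\ ex_RInt f a b).
  { intros n. pose proof (lt_0_INR (S n) ltac:(lia)) as Hn.
    assert (He : 0 <= D / INR (S n)) by (apply Rdiv_le_0_compat; lra).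
    destruct (antitone_step_approx c a b (g b) (D / INR (S n)) (S n) Hab Hc He g Hg)
      as [h [Hh Hi]].
    - intros x Hx. replace (g b + INR (S n) * (D / INR (S n))) with (g a).
      + split; apply Hg; lra.
      + unfold D. field. lra.
    (* Outside [a, b] the approximant is the limit itself, so that convergence is uniform on the
       whole line, as [filterlim_RInt] asks. *)
    - exists (fun x => if excluded_middle_informative (a <= x <= b) then c x * h x else c x * g x).
      split.
      + intros x. destruct (excluded_middle_informative (a <= x <= b)) as [Hx|Hx].
        * rewrite <- Rmult_minus_distr_l, Rabs_mult.
          apply Rmult_le_compat; try apply Rabs_pos; [apply (HB x Hx)|].
          specialize (Hh x Hx). apply Rabs_le. lra.
        * rewrite Rminus_diag, Rabs_R0. nra.
      + apply (ex_RInt_ext (fun x => c x * h x)); [|exact Hi].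
        intros x. rewrite Rmin_left, Rmax_right by lra. intros Hx.
        destruct (excluded_middle_informative (a <= x <= b)) as [|N]; [reflexivity|].
        exfalso; apply N; lra. }
  pose (F := fun n => proj1_sig (constructive_indefinite_description _ (Hex n))).
  assert (HF : forall n, (forall x, Rabs (F n x - c x * g x) <= B * (D / INR (S n))) /\
    ex_RInt (F n) a b).
  { intros n. unfold F. exact (proj2_sig (constructive_indefinite_description _ (Hex n))). }
  destruct (filterlim_RInt (V := R_CompleteNormedModule) F a b eventually _
    (fun x => c x * g x) (fun n => RInt (F n) a b)) as [I [_ HI]].
  - intros n. apply (RInt_correct (V := R_CompleteNormedModule)), HF.
  - apply (filterlim_locally (U := fct_UniformSpace R R_UniformSpace)). intros eps.
    destruct (nfloor_ex (B * D / eps)) as [n [_ Hn]].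
    { apply Rdiv_le_0_compat; [nra|apply cond_pos]. }
    exists n. intros k Hk x. change (Rabs (F k x - c x * g x) < eps).
    eapply Rle_lt_trans; [apply HF|].
    pose proof (lt_0_INR (S k) ltac:(lia)) as Hk0. pose proof (cond_pos eps).
    apply le_INR in Hk. rewrite S_INR in *.
    apply (Rmult_lt_reg_r (INR k + 1)); [lra|].
    replace (B * (D / (INR k + 1)) * (INR k + 1)) with (B * D) by (field; lra).
    apply (Rmult_lt_compat_r eps) in Hn; [|lra].
    replace (B * D / eps * eps) with (B * D) in Hn by (field; lra). nra.
  - now exists I.
Qed.

(** The properties shared by Phi_0 and the Phi_i on which the comparison rests. Strict growth holds
    only from some [x0] on, because phi_i may be constant at first; [profile_quadratic] is
    domination by Phi_0. *)
Record weight_profile (f : R -> R) : Prop := {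
  profile_0 : f 0 = 0;
  profile_pos : forall x, 0 < x -> 0 < f x;
  profile_mono : forall x y, 0 <= x -> x <= y -> f x <= f y;
  profile_scale : forall c x, 1 <= c -> 0 <= x -> f (c * x) <= c ^ 2 * f x;
  profile_unbounded : forall y, exists x, 0 <= x /\ y < f x;
  profile_strict : exists x0, 0 < x0 /\ forall x y, 0 <= x -> x0 <= y -> x < y -> f x < f y;
  profile_quadratic : exists K, 1 <= K /\ forall x, 0 <= x -> f x <= K * Rmax x (x ^ 2)
}.

(* The scaling bound replaces continuity here: it forbids jumps. *)
Lemma profile_surjective f y : weight_profile f -> 0 <= y -> exists x, 0 <= x /\ f x = y.
Proof.
  intros W Hy. destruct (Rle_lt_or_eq_dec 0 y Hy) as [Hy0|<-].
  2: { exists 0. split; [lra|apply (profile_0 f W)]. }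
  destruct (profile_quadratic f W) as [K [HK Hq]].
  destruct (profile_unbounded f W y) as [M [HM0 HM]].
  set (E := fun x => 0 <= x /\ f x <= y).
  assert (Hlow : exists x, 0 < x /\ E x).
  (* On [0, 1] the quadratic bound is linear: f(x) <= K x <= y. *)
  { exists (Rmin 1 (y / K)).
    assert (0 < y / K) by (apply Rdiv_lt_0_compat; lra).
    assert (0 < Rmin 1 (y / K)) by (apply Rmin_glb_lt; lra).
    pose proof (Rmin_l 1 (y / K)). pose proof (Rmin_r 1 (y / K)).
    set (x := Rmin 1 (y / K)) in *. split; [lra|]. split; [lra|].
    eapply Rle_trans; [apply Hq; lra|].
    rewrite Rmax_left by nra. apply (Rmult_le_compat_l K) in H2; [|lra].
    replace (K * (y / K)) with y in H2 by (field; lra). exact H2. }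
  destruct Hlow as [x1 [Hx1 HE1]].
  destruct (completeness E) as [s [Hs1 Hs2]].
  - exists M. intros x [Hx Hx']. apply Rnot_lt_le. intros N.
    pose proof (profile_mono f W M x HM0 (Rlt_le _ _ N)). lra.
  - now exists x1.
  - assert (Hs : 0 < s). { specialize (Hs1 x1 HE1). lra. }
    exists s. split; [lra|].
    (* Replaces the limit c -> 1. It is used twice at the supremum [s] of the set where f <= y:
       points of this set above s/c give f(s) <= c^2 y, and the point c s beyond it gives y <= c^2
       f(s). *)
    assert (Hsq : forall z w, 0 < z -> (forall c, 1 < c -> w <= c ^ 2 * z) -> w <= z).
    { intros z w Hz Hc. apply Rnot_lt_le. intros N.
      assert (1 < w / z). { apply (Rmult_lt_reg_r z); [lra|]. replace (w / z * z) with w by (field; lra). lra. }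
      set (q := w / z) in *. assert (w = q * z) by (unfold q; field; lra).
      pose proof (sqrt_lt_1 1 ((1 + q) / 2)) as S1. rewrite sqrt_1 in S1.
      specialize (Hc (sqrt ((1 + q) / 2)) ltac:(apply S1; lra)).
      rewrite <- Rsqr_pow2, Rsqr_sqrt in Hc by lra. nra. }
    apply Rle_antisym.
    + apply Hsq; [lra|]. intros c Hc.
      assert (Hx : exists x, E x /\ s / c < x).
      { apply NNPP. intros N. assert (s <= s / c).
        - apply Hs2. intros x Hx. apply Rnot_lt_le. intros H. apply N. now exists x.
        - apply (Rmult_le_compat_r c) in H; [|lra].
          replace (s / c * c) with s in H by (field; lra).
          assert (0 < s * (c - 1)) by (apply Rmult_lt_0_compat; lra). lra. }
      destruct Hx as [x [[Hx0 Hx] Hlt]].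
      assert (s <= c * x).
      { apply (Rmult_lt_compat_l c) in Hlt; [|lra].
        replace (c * (s / c)) with s in Hlt by (field; lra). lra. }
      pose proof (profile_mono f W s (c * x) ltac:(lra) H).
      pose proof (profile_scale f W c x ltac:(lra) Hx0). nra.
    + apply Hsq; [now apply (profile_pos f W)|]. intros c Hc.
      apply Rnot_lt_le. intros N.
      pose proof (profile_scale f W c s ltac:(lra) ltac:(lra)).
      assert (H1 : c * s <= s) by (apply Hs1; split; [apply Rmult_le_pos; lra|lra]).
      assert (0 < (c - 1) * s) by (apply Rmult_lt_0_compat; lra). lra.
Qed.

Lemma inv_on_spec f y : weight_profile f -> 0 <= y -> 0 <= inv_on f y /\ f (inv_on f y) = y.
Proof.
  intros W Hy. unfold inv_on. apply epsilon_spec. now apply profile_surjective.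
Qed.

Lemma weight_profile_Phi0 : weight_profile (fun t => Rmax t (t ^ 2)).
Proof.
  split.
  - rewrite Rmax_left; lra.
  - intros x Hx. apply Rlt_le_trans with (2 := Rmax_l _ _). exact Hx.
  - intros x y Hx Hy. apply Rmax_lub.
    + apply Rle_trans with (2 := Rmax_l _ _). exact Hy.
    + apply Rle_trans with (2 := Rmax_r _ _). nra.
  - intros c x Hc Hx. pose proof (Rmax_l x (x ^ 2)). pose proof (Rmax_r x (x ^ 2)).
    assert (c * 1 <= c * c) by (apply Rmult_le_compat_l; lra).
    apply Rmax_lub.
    + apply Rle_trans with (c ^ 2 * x); [apply Rmult_le_compat_r; lra|].
      apply Rmult_le_compat_l; nra.
    + rewrite Rpow_mult_distr. apply Rmult_le_compat_l; nra.
  - intros y. exists (Rmax 0 (y + 1)). pose proof (Rmax_l 0 (y + 1)).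
    pose proof (Rmax_r 0 (y + 1)). split; [lra|].
    apply Rlt_le_trans with (2 := Rmax_l _ _). lra.
  - exists 1. split; [lra|]. intros x y Hx _ Hxy. apply Rmax_lub_lt.
    + apply Rlt_le_trans with (2 := Rmax_l _ _). exact Hxy.
    + apply Rlt_le_trans with (2 := Rmax_r _ _). nra.
  - exists 1. split; [lra|]. intros x _. lra.
Qed.

(** * The profile of Phi_i for a regularly varying phi_i *)

Section RegularPhi.
Variable phi : R -> R.
Hypothesis phi_pos : forall t, 0 <= t -> 0 < phi t.
Hypothesis phi_mono : forall s t, 0 <= s -> s <= t -> phi s <= phi t.
Hypothesis phi_reg : regularly_varying_pos phi.

(** The index is positive, so eventually phi(2t) >= (1 + q) phi(t) with q > 0 half the excess of
    2^gam over 1. Iteration and Bernoulli's inequality [poly] give growth along [2 ^ n * T']. *)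
Lemma regular_unbounded y : exists t, 1 <= t /\ y < phi t.
Proof.
  destruct phi_reg as [gam [Hg Hr]].
  assert (H2 : 1 < Rpower 2 gam) by (rewrite <- (Rpower_O 2) by lra; apply Rpower_lt; lra).
  set (q := (Rpower 2 gam - 1) / 2).
  destruct (Hr 2 ltac:(lra) q ltac:(unfold q; lra)) as [T HT].
  set (T' := Rmax T 1).
  assert (HT1 : 1 <= T') by apply Rmax_r. assert (HT2 : T <= T') by apply Rmax_l.
  assert (Hq : 0 < q) by (unfold q; lra).
  assert (Hstep : forall t, T' <= t -> (1 + q) * phi t <= phi (2 * t)).
  { intros t Ht. specialize (HT t ltac:(lra)). apply Rabs_def2 in HT as [_ HT].
    assert (Hp : 0 < phi t) by (apply phi_pos; lra).
    assert (1 + q <= phi (2 * t) / phi t) by (unfold q in *; lra).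
    apply (Rmult_le_compat_r (phi t)) in H; [|lra].
    replace (phi (2 * t) / phi t * phi t) with (phi (2 * t)) in H by (field; lra). exact H. }
  assert (Hp : 0 < phi T') by (apply phi_pos; lra).
  assert (Hn : forall n, T' <= 2 ^ n * T' /\ (1 + q) ^ n * phi T' <= phi (2 ^ n * T')).
  { induction n as [|n [I1 I2]]; [simpl; rewrite !Rmult_1_l; lra|].
    simpl. rewrite !Rmult_assoc. split; [lra|].
    specialize (Hstep _ I1). apply Rle_trans with (2 := Hstep).
    apply Rmult_le_compat_l; lra. }
  destruct (INR_unbounded (Rmax 0 (y / (q * phi T')))) as [n Hlarge].
  exists (2 ^ n * T'). destruct (Hn n) as [I1 I2]. split; [lra|].
  apply Rlt_le_trans with (2 := I2).
  pose proof (poly n q Hq) as Hb.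
  assert (y / (q * phi T') < INR n) by (eapply Rle_lt_trans; [apply Rmax_r|exact Hlarge]).
  assert (0 < q * phi T') by nra.
  apply (Rmult_lt_compat_r (q * phi T')) in H; [|lra].
  replace (y / (q * phi T') * (q * phi T')) with y in H by (field; lra). nra.
Qed.

Let f (s : R) := 2 * s / phi s.
Let I (t : R) := integral0 f t.

Lemma ex_RInt_density a b : 0 <= a -> a <= b -> ex_RInt f a b.
Proof.
  intros Ha Hab.
  apply (ex_RInt_mult_antitone (fun s => 2 * s) (fun s => / phi s)); [exact Hab| |].
  - intros x. apply (continuous_mult (fun _ => 2) (fun s => s));
    [apply continuous_const|apply continuous_id].
  - intros x y Hx Hxy Hy. apply Rinv_le_contravar; [apply phi_pos; lra|].
    apply phi_mono; lra.
Qed.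

Lemma integral0_RInt t : 0 <= t -> I t = RInt f 0 t.
Proof.
  intros Ht. unfold I, integral0.
  set (P := fun J => exists pr : Riemann_integrable f 0 t, RiemannInt pr = J).
  assert (HP : P (epsilon (inhabits 0) P)).
  { apply epsilon_spec. exists (RiemannInt (ex_RInt_Reals_0 f 0 t (ex_RInt_density 0 t (Rle_refl 0) Ht))).
    now eexists. }
  destruct HP as [pr <-]. symmetry. apply RInt_Reals.
Qed.

Lemma RInt_linear k a b : RInt (fun s => 2 * s * k) a b = (b ^ 2 - a ^ 2) * k.
Proof.
  replace ((b ^ 2 - a ^ 2) * k) with (minus (b ^ 2 * k) (a ^ 2 * k))
    by (unfold minus, plus, opp; simpl; ring).
  apply is_RInt_unique.
  apply (is_RInt_derive (V := R_CompleteNormedModule) (fun s => s ^ 2 * k)).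
  - intros x _. AutoDerive.auto_derive; [trivial|ring].
  - intros x _. apply (continuous_mult (fun s => 2 * s) (fun _ => k)); [|apply continuous_const].
    apply (continuous_mult (fun _ => 2) (fun s => s)); [apply continuous_const|apply continuous_id].
Qed.

Lemma integral_increment a b : 0 <= a -> a <= b ->
  (b ^ 2 - a ^ 2) / phi b <= I b - I a <= (b ^ 2 - a ^ 2) / phi a.
Proof.
  intros Ha Hab.
  assert (E : I b - I a = RInt f a b).
  { rewrite !integral0_RInt by lra.
    rewrite <- (RInt_Chasles f 0 a b) by (apply ex_RInt_density; lra).
    unfold plus; simpl. ring. }
  rewrite E. unfold Rdiv. rewrite <- !RInt_linear.
  assert (HL : forall k, ex_RInt (fun s => 2 * s * k) a b).
  { intros k. apply (ex_RInt_continuous (V := R_CompleteNormedModule)). intros x _.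
    apply (continuous_mult (fun s => 2 * s) (fun _ => k)); [|apply continuous_const].
    apply (continuous_mult (fun _ => 2) (fun s => s)); [apply continuous_const|apply continuous_id]. }
  split; apply RInt_le; auto using ex_RInt_density; intros x Hx; unfold f, Rdiv;
  (apply Rmult_le_compat_l; [lra|]); apply Rinv_le_contravar; try (apply phi_pos; lra);
  apply phi_mono; lra.
Qed.

Lemma integral_at_0 : I 0 = 0.
Proof. rewrite integral0_RInt by lra. apply (RInt_point (V := R_CompleteNormedModule)). Qed.

Lemma integral_lower t : 0 <= t -> t ^ 2 / phi t <= I t.
Proof.
  intros Ht. pose proof (integral_increment 0 t ltac:(lra) Ht) as [H _].
  rewrite integral_at_0 in H. replace (t ^ 2 - 0 ^ 2) with (t ^ 2) in H by ring. lra.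
Qed.

Lemma integral_mono a b : 0 <= a -> a <= b -> I a <= I b.
Proof.
  intros Ha Hab. pose proof (integral_increment a b Ha Hab) as [H _].
  assert (0 <= (b ^ 2 - a ^ 2) / phi b); [|lra].
  apply Rdiv_le_0_compat; [nra|apply phi_pos; lra].
Qed.

Lemma integral_pos t : 1 <= t -> 0 < I 1 <= I t.
Proof.
  intros Ht. split; [|apply integral_mono; lra].
  apply Rlt_le_trans with (2 := integral_lower 1 ltac:(lra)).
  apply Rdiv_lt_0_compat; [lra|apply phi_pos; lra].
Qed.

Lemma PhiReg_large t : 1 <= t -> PhiReg phi t = t ^ 2 / I t.
Proof. intros Ht. unfold PhiReg. destruct (Rle_dec 1 t); [reflexivity|lra]. Qed.

Lemma PhiReg_small t : t <= 1 -> PhiReg phi t = t / I 1.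
Proof.
  intros Ht. unfold PhiReg. pose proof (integral_pos 1 ltac:(lra)).
  destruct (Rle_dec 1 t) as [H1|H1].
  - replace t with 1 by lra. fold f. fold (I 1). field. lra.
  - fold f. fold (I 1). field. lra.
Qed.

Lemma ratio_le a b c d : 0 < b -> 0 < d -> a * d <= c * b -> a / b <= c / d.
Proof.
  intros Hb Hd H. apply (Rmult_le_reg_r (b * d)); [nra|].
  replace (a / b * (b * d)) with (a * d) by (field; lra).
  replace (c / d * (b * d)) with (c * b) by (field; lra). exact H.
Qed.

Lemma ratio_lt a b c d : 0 < b -> 0 < d -> a * d < c * b -> a / b < c / d.
Proof.
  intros Hb Hd H. apply (Rmult_lt_reg_r (b * d)); [nra|].
  replace (a / b * (b * d)) with (a * d) by (field; lra).
  replace (c / d * (b * d)) with (c * b) by (field; lra). exact H.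
Qed.

(** Cross-multiplied, the claim is a^2 (I b - I a) <= I a (b^2 - a^2), which combines I b - I a <=
    (b^2 - a^2)/phi(a) with a^2/phi(a) <= I a. *)
Lemma PhiReg_mono_large a b : 1 <= a -> a <= b -> PhiReg phi a <= PhiReg phi b.
Proof.
  intros Ha Hab. rewrite !PhiReg_large by lra.
  pose proof (integral_pos a Ha). pose proof (integral_pos b ltac:(lra)).
  pose proof (integral_increment a b ltac:(lra) Hab) as [_ Hi].
  pose proof (integral_lower a ltac:(lra)) as Hl.
  assert (Hp : 0 < phi a) by (apply phi_pos; lra).
  apply ratio_le; try lra.
  assert (HX : a ^ 2 * ((b ^ 2 - a ^ 2) / phi a) <= I a * (b ^ 2 - a ^ 2)).
  { replace (a ^ 2 * ((b ^ 2 - a ^ 2) / phi a)) with (a ^ 2 / phi a * (b ^ 2 - a ^ 2))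
      by (field; lra).
    apply Rmult_le_compat_r; [nra|exact Hl]. }
  apply (Rmult_le_compat_l (a ^ 2)) in Hi; [|nra]. nra.
Qed.

(** The computation of [PhiReg_mono_large], now strict: on [0, 1] phi stays at most [phi 1 < phi a],
    whence a^2/phi(a) < I a. *)
Lemma PhiReg_strict_large a b : 1 <= a -> a < b -> phi 1 < phi a ->
  PhiReg phi a < PhiReg phi b.
Proof.
  intros Ha Hab Hphi. rewrite !PhiReg_large by lra.
  pose proof (integral_pos a Ha). pose proof (integral_pos b ltac:(lra)).
  pose proof (integral_increment a b ltac:(lra) ltac:(lra)) as [_ Hi].
  assert (Hp1 : 0 < phi 1) by (apply phi_pos; lra).
  assert (Hl : a ^ 2 / phi a < I a).
  { pose proof (integral_increment 1 a ltac:(lra) Ha) as [H1 _].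
    pose proof (integral_lower 1 ltac:(lra)) as H2.
    assert (1 ^ 2 / phi a < 1 ^ 2 / phi 1) by (apply ratio_lt; lra).
    unfold Rdiv in *. rewrite Rmult_minus_distr_r in H1. lra. }
  assert (HX : a ^ 2 * ((b ^ 2 - a ^ 2) / phi a) < I a * (b ^ 2 - a ^ 2)).
  { replace (a ^ 2 * ((b ^ 2 - a ^ 2) / phi a)) with (a ^ 2 / phi a * (b ^ 2 - a ^ 2))
      by (field; lra).
    apply Rmult_lt_compat_r; [nra|exact Hl]. }
  apply ratio_lt; try lra.
  apply (Rmult_le_compat_l (a ^ 2)) in Hi; [|nra]. nra.
Qed.

Lemma PhiReg_mono a b : 0 <= a -> a <= b -> PhiReg phi a <= PhiReg phi b.
Proof.
  intros Ha Hab. pose proof (integral_pos 1 ltac:(lra)).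
  assert (Hs : forall x y, x <= y -> y <= 1 -> PhiReg phi x <= PhiReg phi y).
  { intros x y Hxy Hy. rewrite !PhiReg_small by lra. apply ratio_le; nra. }
  destruct (Rle_dec b 1); [now apply Hs|].
  destruct (Rle_dec 1 a); [now apply PhiReg_mono_large|].
  apply Rle_trans with (PhiReg phi 1); [apply Hs; lra|apply PhiReg_mono_large; lra].
Qed.

(** The denominator I is nondecreasing, so t^2/I(t) grows at most quadratically. When x < 1 < c x,
    the linear piece is compared with the quadratic one through x^2 <= x. *)
Lemma PhiReg_scale c x : 1 <= c -> 0 <= x -> PhiReg phi (c * x) <= c ^ 2 * PhiReg phi x.
Proof.
  intros Hc Hx. assert (Hcc : c <= c ^ 2) by nra.
  pose proof (integral_pos 1 ltac:(lra)) as H1.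
  assert (Hcx : x <= c * x) by nra.
  destruct (Rle_dec (c * x) 1) as [L|L].
  - rewrite !PhiReg_small by lra.
    replace (c ^ 2 * (x / I 1)) with (c ^ 2 * x / I 1) by (field; lra).
    apply ratio_le; try lra. apply Rmult_le_compat_r; [lra|].
    apply Rmult_le_compat_r; lra.
  - rewrite PhiReg_large by lra. pose proof (integral_pos (c * x) ltac:(lra)) as H2.
    destruct (Rle_dec 1 x) as [Lx|Lx].
    + rewrite PhiReg_large by lra. pose proof (integral_pos x Lx).
      pose proof (integral_mono x (c * x) Hx Hcx).
      replace (c ^ 2 * (x ^ 2 / I x)) with ((c * x) ^ 2 / I x) by (field; lra).
      apply ratio_le; try lra. apply Rmult_le_compat_l; [nra|lra].
    + rewrite PhiReg_small by lra.
      replace (c ^ 2 * (x / I 1)) with (c ^ 2 * x / I 1) by (field; lra).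
      apply ratio_le; try lra.
      assert (Hxx : x ^ 2 <= x) by (simpl; rewrite Rmult_1_r;
        rewrite <- (Rmult_1_r x) at 3; apply Rmult_le_compat_l; lra).
      rewrite Rpow_mult_distr.
      assert (0 <= c ^ 2) by lra. assert (0 <= x ^ 2) by (apply pow_le; lra).
      apply Rmult_le_compat; try lra; [apply Rmult_le_pos; lra|].
      apply Rmult_le_compat_l; lra.
Qed.

Lemma PhiReg_unbounded y : exists x, 0 <= x /\ y < PhiReg phi x.
Proof.
  destruct (regular_unbounded (2 * y)) as [A [HA Hy]].
  assert (Hp : 0 < phi A) by (apply phi_pos; lra).
  pose proof (integral_pos A HA) as HIA.
  (* Beyond [A] the density is at most 2s/phi(A). This [t] is so large that also I A <= t^2/phi(A);
     hence I t <= 2 t^2/phi(A), and Phi(t) >= phi(A)/2 > y. *)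
  set (t := A + I A * phi A + 1).
  assert (HIp : 0 < I A * phi A) by (apply Rmult_lt_0_compat; lra).
  exists t. split; [unfold t; nra|].
  assert (Ht : A <= t /\ 1 <= t) by (unfold t; lra).
  rewrite PhiReg_large by lra.
  pose proof (integral_increment A t ltac:(lra) ltac:(lra)) as [_ Hi].
  pose proof (integral_pos t ltac:(lra)).
  assert (H1 : I A <= t ^ 2 / phi A).
  { replace (I A) with (I A * phi A / phi A) by (field; lra).
    apply ratio_le; try lra. apply Rmult_le_compat_r; [lra|].
    assert (I A * phi A <= t) by (unfold t; lra). nra. }
  assert (H2 : I t <= 2 * (t ^ 2 / phi A)).
  { unfold Rdiv in *. rewrite Rmult_minus_distr_r in Hi.
    assert (0 <= A ^ 2 * / phi A); [|lra].
    apply Rmult_le_pos; [nra|]. left. now apply Rinv_0_lt_compat. }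
  assert (H3 : phi A / 2 <= t ^ 2 / I t).
  { apply ratio_le; try lra.
    apply (Rmult_le_compat_r (phi A)) in H2; [|lra].
    replace (2 * (t ^ 2 / phi A) * phi A) with (t ^ 2 * 2) in H2 by (field; lra). lra. }
  lra.
Qed.

Lemma weight_profile_PhiReg : weight_profile (PhiReg phi).
Proof.
  pose proof (integral_pos 1 ltac:(lra)) as H1.
  split.
  - rewrite PhiReg_small by lra. field. lra.
  - intros x Hx. destruct (Rle_dec x 1).
    + rewrite PhiReg_small by lra. apply Rdiv_lt_0_compat; lra.
    + rewrite PhiReg_large by lra. pose proof (integral_pos x ltac:(lra)).
      apply Rdiv_lt_0_compat; [nra|lra].
  - apply PhiReg_mono.
  - apply PhiReg_scale.
  - apply PhiReg_unbounded.
  - destruct (regular_unbounded (phi 1)) as [A [HA Hphi]].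
    exists (A + 1). split; [lra|]. intros x y Hx Hy Hxy.
    (* [x] may lie where Phi is still constant; [z] lies between [x] and [y] and beyond that
       range. *)
    set (z := Rmax A x). assert (A <= z) by apply Rmax_l. assert (x <= z) by apply Rmax_r.
    assert (z < y) by (apply Rmax_lub_lt; lra).
    apply Rle_lt_trans with (PhiReg phi z); [now apply PhiReg_mono|].
    apply PhiReg_strict_large; try lra.
    apply Rlt_le_trans with (1 := Hphi). apply phi_mono; lra.
  - exists (Rmax 1 (/ I 1)). split; [apply Rmax_l|]. intros x Hx.
    pose proof (Rmax_r 1 (/ I 1)) as HK. set (K := Rmax 1 (/ I 1)) in *.
    pose proof (Rmax_l x (x ^ 2)). pose proof (Rmax_r x (x ^ 2)).
    assert (0 < / I 1) by (apply Rinv_0_lt_compat; lra).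
    destruct (Rle_dec x 1).
    + rewrite PhiReg_small by lra. unfold Rdiv. rewrite Rmult_comm.
      apply Rmult_le_compat; lra.
    + rewrite PhiReg_large by lra. pose proof (integral_pos x ltac:(lra)).
      unfold Rdiv. rewrite Rmult_comm.
      apply Rmult_le_compat; [left; apply Rinv_0_lt_compat; lra|nra| |lra].
      apply Rle_trans with (2 := HK). apply Rinv_le_contravar; lra.
Qed.

End RegularPhi.

(** * Words and weighted norms *)

(** Turns constants chosen separately for finitely many indices into a common one; directedness is
    all that is used, which covers lengths and real constants alike. *)
Lemma finite_upper_bound (T : Type) (t0 : T) (le : T -> T -> Prop) (P : nat -> T -> Prop) :
  (forall x y, exists z, le x z /\ le y z) -> (forall i x y, P i x -> le x y -> P i y) ->
  forall n, (forall i, (i < n)%nat -> exists x, P i x) ->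
  exists x, forall i, (i < n)%nat -> P i x.
Proof.
  intros J M. induction n as [|n IH]; intros H.
  - exists t0. intros; lia.
  - destruct IH as [x Hx]; [intros; apply H; lia|].
    destruct (H n ltac:(lia)) as [y Hy]. destruct (J x y) as [z [Hz1 Hz2]].
    exists z. intros i Hi. destruct (Nat.eq_dec i n) as [->|]; [eauto|].
    apply (M i x); [apply Hx; lia|exact Hz1].
Qed.

Lemma finite_upper_bound_nat (P : nat -> nat -> Prop) (n : nat) :
  (forall i x y, P i x -> (x <= y)%nat -> P i y) ->
  (forall i, (i < n)%nat -> exists x, P i x) ->
  exists x, forall i, (i < n)%nat -> P i x.
Proof.
  intros M. apply (finite_upper_bound nat 0%nat le P); [|exact M].
  intros x y. exists (Nat.max x y). lia.
Qed.

Lemma finite_upper_bound_R (P : nat -> R -> Prop) (n : nat) :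
  (forall i x y, P i x -> x <= y -> P i y) ->
  (forall i, (i < n)%nat -> exists x, P i x) ->
  exists x, forall i, (i < n)%nat -> P i x.
Proof.
  intros M. apply (finite_upper_bound R 0 Rle P); [|exact M].
  intros x y. exists (Rmax x y). split; [apply Rmax_l|apply Rmax_r].
Qed.

Lemma maxR_ge n t i : (i < n)%nat -> t i <= maxR n t.
Proof.
  intros Hi. assert (I : In i (seq 0 n)) by (apply in_seq; lia).
  unfold maxR. induction (seq 0 n) as [|j l IH]; [easy|].
  simpl. destruct I as [->|I]; [apply Rmax_l|].
  eapply Rle_trans; [now apply IH|apply Rmax_r].
Qed.

Lemma maxR_nonneg n t : 0 <= maxR n t.
Proof.
  unfold maxR. induction (seq 0 n) as [|j l IH]; simpl; [lra|].
  eapply Rle_trans; [exact IH|apply Rmax_r].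
Qed.

Lemma maxR_le n t B : 0 <= B -> (forall i, (i < n)%nat -> t i <= B) -> maxR n t <= B.
Proof.
  intros HB H. assert (H' : forall i, In i (seq 0 n) -> t i <= B).
  { intros i I. apply in_seq in I. apply H. lia. }
  clear H. unfold maxR. induction (seq 0 n) as [|j l IH]; simpl; [lra|].
  apply Rmax_lub; [apply H'; now left|apply IH; intros i I; apply H'; now right].
Qed.

Lemma glb_exists (E : R -> Prop) : (exists r, E r) -> (forall r, E r -> 0 <= r) ->
  exists x, is_glb E x.
Proof.
  intros [r Hr] H0.
  destruct (completeness (fun x => E (- x))) as [m [H1 H2]].
  - exists 0. intros x Hx. specialize (H0 _ Hx). lra.
  - exists (- r). now rewrite Ropp_involutive.
  - exists (- m). split.
    + intros y Hy. assert (- y <= m); [|lra]. apply H1. now rewrite Ropp_involutive.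
    + intros b Hb. assert (m <= - b); [|lra]. apply H2. intros x Hx. specialize (Hb _ Hx). lra.
Qed.

Lemma deg_app i w1 w2 : deg i (w1 ++ w2) = (deg i w1 + deg i w2)%nat.
Proof. unfold deg. now rewrite filter_app, length_app. Qed.

Lemma deg_le_length i w : (deg i w <= length w)%nat.
Proof. apply filter_length_le. Qed.

Lemma deg_pos i w : (0 < deg i w)%nat -> exists a, In a w /\ fst a = i.
Proof.
  unfold deg. destruct (filter _ w) as [|a l] eqn:E; simpl; [lia|]. intros _.
  assert (I : In a (filter (fun a => Nat.eqb (fst a) i) w)) by (rewrite E; now left).
  apply filter_In in I as [I1 I2]. exists a. split; [exact I1|now apply Nat.eqb_eq].
Qed.

Lemma word_eval_app (G : group) (Sigma : list G) w1 w2 :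
  word_eval G Sigma (w1 ++ w2) = gmul (word_eval G Sigma w1) (word_eval G Sigma w2).
Proof. unfold word_eval. now rewrite map_app, gprod_app. Qed.

Lemma word_eval_concat_repeat (G : group) (Sigma : list G) w n :
  word_eval G Sigma (concat (repeat w n)) = gpow (word_eval G Sigma w) n.
Proof.
  induction n as [|n IH]; simpl; [reflexivity|]. now rewrite word_eval_app, IH.
Qed.

Lemma Forall_concat_repeat (A : Type) (P : A -> Prop) w n :
  Forall P w -> Forall P (concat (repeat w n)).
Proof. intros H. induction n; simpl; [constructor|]. now apply Forall_app. Qed.

Lemma length_concat_repeat (A : Type) (w : list A) n :
  length (concat (repeat w n)) = (n * length w)%nat.
Proof. induction n as [|n IH]; simpl; [reflexivity|]. rewrite length_app, IH. reflexivity. Qed.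

Definition valid {G : group} (Sigma : list G) (w : list (nat * bool)) : Prop :=
  Forall (fun a => (fst a < length Sigma)%nat) w.

(** * A single geometry: weights of words and values of the norm *)

Section Geometry.
Variables (G : group) (Phi : nat -> R -> R) (k : nat) (Sigma : list G).
Variable mem : nat -> G -> Prop.
Hypothesis profile : forall i, (i <= k)%nat -> weight_profile (Phi i).
Hypothesis mem_inv : forall i x, (i <= k)%nat -> mem i x -> mem i (ginv x).
Hypothesis Sigma_rep : rep_set G (fun x => (exists i, (i <= k)%nat /\ mem i x) /\ x <> gone) Sigma.

Notation letter j := (nth j Sigma gone).

Lemma letter_mem j : (j < length Sigma)%nat -> exists i, (i <= k)%nat /\ mem i (letter j).
Proof. intros Hj. apply Sigma_rep. now apply nth_In. Qed.

Lemma letter_nontrivial j : (j < length Sigma)%nat -> letter j <> gone.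
Proof. intros Hj. apply Sigma_rep. now apply nth_In. Qed.

Lemma letter_of x : x <> gone -> (exists i, (i <= k)%nat /\ mem i x) ->
  exists a, (fst a < length Sigma)%nat /\ letter_val G Sigma a = x /\
    forall i, (i <= k)%nat -> mem i x -> mem i (letter (fst a)).
Proof.
  intros Hx Hm. destruct Sigma_rep as [_ [_ H3]].
  destruct (H3 x (conj Hm Hx)) as [s [[Is Es] _]].
  destruct (In_nth Sigma s gone Is) as [j [Hj Ej]].
  destruct Es as [-> | ->].
  - exists (j, false). unfold letter_val; simpl. rewrite Ej. auto.
  - exists (j, true). unfold letter_val; simpl. rewrite Ej, ginvK. auto.
Qed.

Lemma word_of_list i l : (i <= k)%nat -> Forall (mem i) l ->
  exists w, valid Sigma w /\ word_eval G Sigma w = gprod G l /\ (length w <= length l)%nat /\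
    forall a, In a w -> mem i (letter (fst a)).
Proof.
  intros Hi. induction 1 as [|x l Hx Hl [w [V [E [L M]]]]].
  - exists []. repeat split; [constructor|simpl; lia|easy].
  - destruct (classic (x = gone)) as [->|N].
    + exists w. simpl. rewrite gmul1l. repeat split; auto.
    + destruct (letter_of x N) as [a [Ha [Ea Ma]]]; [eauto|].
      exists (a :: w). repeat split.
      * now constructor.
      * unfold word_eval in *. simpl. now rewrite Ea, E.
      * simpl; lia.
      * intros b [<-|I]; auto.
Qed.

Lemma word_of_elt i (H : G -> Prop) l x : (i <= k)%nat -> fin_sym_gen G H l ->
  (forall s, In s l -> mem i s) -> H x ->
  exists w, valid Sigma w /\ word_eval G Sigma w = x /\
    forall a, In a w -> mem i (letter (fst a)).
Proof.
  intros Hi [_ [_ Hg]] Hm Hx. destruct (Hg x Hx) as [s [Fs <-]].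
  destruct (word_of_list i s Hi) as [w [V [E [_ M]]]]; [|eauto].
  eapply Forall_impl; [|exact Fs]. exact Hm.
Qed.

(* Since [F_s] is the maximum of the [Phi_i^-1] with [mem i s], its inverse is the minimum of these
   [Phi_i]: [cheap s y B] says that [F_s^-1(y) <= B]. *)
Definition cheap (s : G) (y : nat) (B : R) : Prop :=
  exists i, (i <= k)%nat /\ mem i s /\ Phi i (INR y) <= B.

Definition cheap_word (w : list (nat * bool)) (B : R) : Prop :=
  valid Sigma w /\ forall j, (j < length Sigma)%nat -> cheap (letter j) (deg j w) B.

Lemma cheap_word_le w B B' : B <= B' -> cheap_word w B -> cheap_word w B'.
Proof.
  intros L [V H]. split; [exact V|]. intros j Hj.
  destruct (H j Hj) as [i [Hi [Hm Hb]]]. exists i. split; [|split]; auto; lra.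
Qed.

(** The [+ 1] keeps the factor at least 1, as the scaling bound requires, even for [c = 0]. *)
Lemma profile_scale_INR i c x y : (i <= k)%nat -> (y <= c * x)%nat ->
  Phi i (INR y) <= (INR c + 1) ^ 2 * Phi i (INR x).
Proof.
  intros Hi Hy. pose proof (pos_INR c). pose proof (pos_INR x). pose proof (pos_INR y).
  apply le_INR in Hy. rewrite mult_INR in Hy.
  apply Rle_trans with (Phi i ((INR c + 1) * INR x)).
  - apply (profile_mono _ (profile i Hi)); nra.
  - apply (profile_scale _ (profile i Hi)); lra.
Qed.

Lemma cheap_scale s c x y B : cheap s x B -> (y <= c * x)%nat ->
  cheap s y ((INR c + 1) ^ 2 * B).
Proof.
  intros [i [Hi [Hm Hb]]] Hy. exists i. split; [exact Hi|split; [exact Hm|]].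
  eapply Rle_trans; [apply (profile_scale_INR i c x y Hi Hy)|].
  apply Rmult_le_compat_l; [apply pow2_ge_0|exact Hb].
Qed.

Lemma cheap_zero j B : (j < length Sigma)%nat -> 0 <= B -> cheap (letter j) 0 B.
Proof.
  intros Hj HB. destruct (letter_mem j Hj) as [i [Hi Hm]]. exists i.
  split; [exact Hi|split; [exact Hm|]]. simpl. rewrite (profile_0 _ (profile i Hi)). exact HB.
Qed.

Lemma cheap_word_nil B : 0 <= B -> cheap_word [] B.
Proof. intros HB. split; [constructor|]. intros j Hj. now apply cheap_zero. Qed.

Lemma cheap_word_app w1 w2 B : cheap_word w1 B -> cheap_word w2 B ->
  cheap_word (w1 ++ w2) (9 * B).
Proof.
  intros [V1 H1] [V2 H2]. split; [now apply Forall_app|]. intros j Hj.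
  (* The degree of the concatenation is at most twice the larger of the two degrees. *)
  replace 9 with ((INR 2 + 1) ^ 2) by (simpl; ring). rewrite deg_app.
  destruct (le_lt_dec (deg j w1) (deg j w2)).
  - apply (cheap_scale _ 2 (deg j w2)); [auto|lia].
  - apply (cheap_scale _ 2 (deg j w1)); [auto|lia].
Qed.

Lemma Phi_nonneg i x : (i <= k)%nat -> 0 <= x -> 0 <= Phi i x.
Proof.
  intros Hi Hx. rewrite <- (profile_0 _ (profile i Hi)) at 1.
  apply (profile_mono _ (profile i Hi)); lra.
Qed.

Lemma cheap_word_uniform i w : (i <= k)%nat -> valid Sigma w ->
  (forall a, In a w -> mem i (letter (fst a))) -> cheap_word w (Phi i (INR (length w))).
Proof.
  intros Hi V M. split; [exact V|]. intros j Hj.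
  destruct (Nat.eq_dec (deg j w) 0) as [->|D].
  - apply cheap_zero; [exact Hj|]. apply Phi_nonneg; [exact Hi|apply pos_INR].
  - destruct (deg_pos j w ltac:(lia)) as [a [Ia <-]]. exists i.
    split; [exact Hi|split; [now apply M|]].
    apply (profile_mono _ (profile i Hi)); [apply pos_INR|apply le_INR, deg_le_length].
Qed.

Lemma cheap_word_exists w : valid Sigma w -> exists B, 0 <= B /\ cheap_word w B.
Proof.
  intros V.
  destruct (finite_upper_bound_R (fun j B => cheap (letter j) (deg j w) B) (length Sigma))
    as [B HB].
  - intros j x y [i [Hi [Hm Hb]]] L. exists i. split; [|split]; auto; lra.
  - intros j Hj. destruct (letter_mem j Hj) as [i [Hi Hm]]. exists (Phi i (INR (deg j w))), i.
    split; [|split]; auto; lra.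
  - exists (Rmax 0 B). split; [apply Rmax_l|]. apply cheap_word_le with B; [apply Rmax_r|].
    split; assumption.
Qed.

(** Some letter of a nonempty word has degree at least 1, so [B] is at least the smallest [Phi i 1].
    This lets additive costs be absorbed into multiplicative constants. *)
Lemma cheap_word_lower : exists K, 1 <= K /\ forall w B, w <> [] -> cheap_word w B -> 1 <= K * B.
Proof.
  destruct (finite_upper_bound_R (fun i K => 1 <= K * Phi i 1 /\ 1 <= K) (S k)) as [K HK].
  - intros i x y [H1 H1'] L. split; [|lra].
    assert (0 < Phi i 1); [|nra]. apply Rnot_le_lt. intros N.
    assert (x * Phi i 1 <= 0); [|lra]. rewrite <- (Rmult_0_r x).
    apply Rmult_le_compat_l; lra.
  - intros i Hi. assert (0 < Phi i 1) by (apply (profile_pos _ (profile i ltac:(lia))); lra).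
    exists (Rmax 1 (/ Phi i 1)). split; [|apply Rmax_l].
    rewrite <- (Rinv_l (Phi i 1)) at 1 by lra. apply Rmult_le_compat_r; [lra|apply Rmax_r].
  - exists K. split; [apply (HK 0%nat); lia|]. intros [|a w] B N [V H]; [easy|].
    pose proof (Forall_inv V) as Va. simpl in Va.
    destruct (H (fst a) Va) as [i [Hi [_ Hb]]].
    destruct (HK i ltac:(lia)) as [H1 H2].
    assert (Phi i 1 <= B).
    { apply Rle_trans with (2 := Hb). apply (profile_mono _ (profile i Hi)); [lra|].
      apply (le_INR 1). unfold deg. simpl. rewrite Nat.eqb_refl. simpl. lia. }
    apply Rle_trans with (1 := H1). apply Rmult_le_compat_l; lra.
Qed.

Lemma wfun_ge i s t : (i <= k)%nat -> mem i s -> inv_on (Phi i) t <= wfun Phi mem k s t.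
Proof.
  intros Hi Hm. unfold wfun.
  assert (I : In i (seq 0 (S k))) by (apply in_seq; lia).
  induction (seq 0 (S k)) as [|j l IH]; [easy|]. simpl.
  destruct I as [->|I].
  - destruct (excluded_middle_informative (mem i s)); [apply Rmax_r|easy].
  - specialize (IH I). destruct (excluded_middle_informative (mem j s)); [|exact IH].
    eapply Rle_trans; [exact IH|apply Rmax_l].
Qed.

Lemma wfun_cases s t : wfun Phi mem k s t = 0 \/
  exists i, (i <= k)%nat /\ mem i s /\ wfun Phi mem k s t = inv_on (Phi i) t.
Proof.
  unfold wfun. assert (I : forall i, In i (seq 0 (S k)) -> (i <= k)%nat).
  { intros i Hi. apply in_seq in Hi. lia. }
  induction (seq 0 (S k)) as [|j l IH]; [now left|]. simpl.
  specialize (IH (fun i H => I i (or_intror H))).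
  destruct (excluded_middle_informative (mem j s)) as [Hj|]; [|exact IH].
  unfold Rmax at 1 3. destruct (Rle_dec _ _); [|exact IH].
  right. exists j. repeat split; auto. apply I. now left.
Qed.

Lemma wfun_preimage s t y : (exists i, (i <= k)%nat /\ mem i s) -> 0 <= t -> wfun Phi mem k s t = y ->
  exists i, (i <= k)%nat /\ mem i s /\ Phi i y = t.
Proof.
  intros [i0 [Hi0 Hm0]] Ht E.
  destruct (wfun_cases s t) as [Z|[i [Hi [Hm Ei]]]].
  (* The maximum is the starting value 0 of the fold; then the inverse at [i0], lying between 0 and
     this maximum, is 0 too. *)
  - exists i0. split; [|split]; auto.
    destruct (inv_on_spec (Phi i0) t (profile i0 Hi0) Ht) as [H1 H2].
    pose proof (wfun_ge i0 s t Hi0 Hm0). replace y with (inv_on (Phi i0) t) by lra. exact H2.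
  - exists i. split; [|split]; auto.
    destruct (inv_on_spec (Phi i) t (profile i Hi) Ht) as [H1 H2]. rewrite <- E, Ei. exact H2.
Qed.

(* [Phi i] may be constant on an initial interval, and then its inverse skips a range of values:
   only large degrees (and 0) are attained by the weight functions. *)
Lemma wfun_attained : exists X, forall s y, (exists i, (i <= k)%nat /\ mem i s) ->
  y = 0 \/ X <= y ->
  0 <= y -> exists t, 0 <= t /\ wfun Phi mem k s t = y /\
    forall i, (i <= k)%nat -> mem i s -> t <= Phi i y.
Proof.
  destruct (finite_upper_bound_R (fun i X => 0 < X /\
    forall x y, 0 <= x -> X <= y -> x < y -> Phi i x < Phi i y) (S k)) as [X HX].
  - intros i x y [H1 H2] L. split; [lra|]. intros x' y' L1 L2 L3. apply H2; lra.
  - intros i Hi. apply (profile_strict _ (profile i ltac:(lia))).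
  - exists X. intros s y Hs Hy Hy0.
    assert (Hmin : forall n, (exists i, (i < n)%nat /\ (i <= k)%nat /\ mem i s) ->
      exists i, (i <= k)%nat /\ mem i s /\
      forall j, (j < n)%nat -> (j <= k)%nat -> mem j s -> Phi i y <= Phi j y).
    { induction n as [|n IH]; intros Hex; [destruct Hex as [i [Hi _]]; lia|].
      destruct (classic (exists i, (i < n)%nat /\ (i <= k)%nat /\ mem i s)) as [Hn|Hn].
      - destruct (IH Hn) as [i [Hi [Hm Hl]]].
        destruct (classic ((n <= k)%nat /\ mem n s)) as [[Hk Hmn]|Nn].
        + destruct (Rle_dec (Phi i y) (Phi n y)).
          * exists i. repeat split; auto. intros j Hj Hjk Hjm.
            destruct (Nat.eq_dec j n) as [->|]; [auto|apply Hl; auto; lia].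
          * exists n. repeat split; auto. intros j Hj Hjk Hjm.
            destruct (Nat.eq_dec j n) as [->|]; [lra|].
            specialize (Hl j ltac:(lia) Hjk Hjm). lra.
        + exists i. repeat split; auto. intros j Hj Hjk Hjm.
          destruct (Nat.eq_dec j n) as [->|]; [tauto|apply Hl; auto; lia].
      - destruct Hex as [i [Hi [Hik Him]]].
        assert (i = n). { destruct (Nat.eq_dec i n); [easy|]. exfalso. apply Hn. exists i.
          repeat split; auto; lia. }
        subst i. exists n. repeat split; auto. intros j Hj Hjk Hjm.
        destruct (Nat.eq_dec j n) as [->|]; [lra|]. exfalso. apply Hn. exists j.
        repeat split; auto; lia. }
    destruct Hs as [i1 [Hi1 Hm1]].
    destruct (Hmin (S k)) as [i [Hi [Hm Hl]]]; [exists i1; repeat split; auto; lia|].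
    assert (Ht : 0 <= Phi i y) by now apply Phi_nonneg.
    exists (Phi i y). split; [exact Ht|]. split; [|intros j Hj Hjm; apply Hl; auto; lia].
    (* [t] is the minimum of the [Phi j y]. An inverse value above [y] would, by strict growth
       beyond [X], give [Phi j y < t]. *)
    assert (Hle : forall j, (j <= k)%nat -> mem j s -> inv_on (Phi j) (Phi i y) <= y).
    { intros j Hj Hjm. specialize (Hl j ltac:(lia) Hj Hjm).
      destruct (inv_on_spec (Phi j) _ (profile j Hj) Ht) as [H1 H2].
      apply Rnot_lt_le. intros N. destruct (HX j ltac:(lia)) as [HX0 HXs].
      destruct Hy as [->|Hy].
      - rewrite (profile_0 _ (profile i Hi)) in *.
        pose proof (profile_pos _ (profile j Hj) _ N). lra.
      - specialize (HXs y (inv_on (Phi j) (Phi i y)) Hy0 ltac:(lra) N). lra. }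
    apply Rle_antisym.
    + destruct (wfun_cases s (Phi i y)) as [->|[j [Hj [Hjm ->]]]]; [exact Hy0|now apply Hle].
    + apply Rle_trans with (2 := wfun_ge i s _ Hi Hm).
      destruct (inv_on_spec (Phi i) _ (profile i Hi) Ht) as [H1 H2].
      apply Rnot_lt_le. intros N. destruct (HX i ltac:(lia)) as [HX0 HXs].
      destruct Hy as [->|Hy]; [lra|]. specialize (HXs _ y H1 Hy N). lra.
Qed.

Lemma wnorm_vals_cheap g r : wnorm_vals G Sigma (wsys Phi mem k Sigma) g r ->
  0 <= r /\ exists w, cheap_word w r /\ word_eval G Sigma w = g.
Proof.
  intros [w [V [E [t [Ht ->]]]]]. split; [apply maxR_nonneg|].
  exists w. split; [split; [exact V|]|exact E]. intros j Hj.
  destruct (Ht j Hj) as [H1 H2].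
  destruct (wfun_preimage _ _ _ (letter_mem j Hj) H1 H2) as [i [Hi [Hm Ei]]].
  exists i. split; [exact Hi|split; [exact Hm|]]. rewrite Ei. now apply maxR_ge.
Qed.

(* Inserting copies of [a^-1 a] moves every nonzero degree beyond the skipped values. *)
Definition pad (m : nat) (w : list (nat * bool)) : list (nat * bool) :=
  flat_map (fun a => a :: concat (repeat [(fst a, negb (snd a)); a] m)) w.

Lemma pad_valid m w : valid Sigma w -> valid Sigma (pad m w).
Proof.
  unfold valid. induction 1 as [|a w Ha Hw IH]; simpl; [constructor|].
  constructor; [exact Ha|]. apply Forall_app; split; [|exact IH].
  apply Forall_concat_repeat. repeat constructor; exact Ha.
Qed.

Lemma deg_pad m j w : deg j (pad m w) = ((2 * m + 1) * deg j w)%nat.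
Proof.
  induction w as [|a w IH]; [unfold deg; simpl; lia|].
  change (pad m (a :: w)) with ([a] ++ concat (repeat [(fst a, negb (snd a)); a] m) ++ pad m w).
  change (a :: w) with ([a] ++ w). rewrite !deg_app, IH.
  assert (E : deg j (concat (repeat [(fst a, negb (snd a)); a] m)) = (2 * m * deg j [a])%nat).
  { clear. induction m as [|m IH]; [reflexivity|].
    change (concat (repeat [(fst a, negb (snd a)); a] (S m)))
      with ([(fst a, negb (snd a)); a] ++ concat (repeat [(fst a, negb (snd a)); a] m)).
    rewrite deg_app, IH. unfold deg. simpl. destruct (fst a =? j)%nat; simpl; lia. }
  rewrite E. lia.
Qed.

Lemma pad_eval m w : word_eval G Sigma (pad m w) = word_eval G Sigma w.
Proof.
  induction w as [|a w IH]; [reflexivity|].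
  change (pad m (a :: w)) with ([a] ++ concat (repeat [(fst a, negb (snd a)); a] m) ++ pad m w).
  change (a :: w) with ([a] ++ w).
  rewrite !word_eval_app, IH, word_eval_concat_repeat. f_equal.
  replace (word_eval G Sigma [(fst a, negb (snd a)); a]) with (gone : G).
  - rewrite gpow_gone, gmul1l. reflexivity.
  - destruct a as [i []]; unfold word_eval, letter_val; simpl; grp.
Qed.

Lemma cheap_wnorm_vals : exists C, 1 <= C /\ forall w B, 0 <= B -> cheap_word w B ->
  exists r, r <= C * B /\
    wnorm_vals G Sigma (wsys Phi mem k Sigma) (word_eval G Sigma w) r.
Proof.
  destruct wfun_attained as [X HX].
  (* Padding multiplies degrees by [2 * m + 1], which exceeds [X], so every nonzero degree becomes
     attained. *)
  destruct (INR_unbounded X) as [m Hm].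
  set (C := (INR (2 * m + 1) + 1) ^ 2).
  assert (HC : 1 <= C) by (unfold C; pose proof (pos_INR (2 * m + 1)); nra).
  exists C. split; [exact HC|]. intros w B HB [V H].
  assert (Ht : forall j, exists t, (j < length Sigma)%nat ->
    0 <= t /\ wfun Phi mem k (letter j) t = INR (deg j (pad m w)) /\ t <= C * B).
  { intros j. destruct (le_lt_dec (length Sigma) j) as [L|Hj]; [exists 0; lia|].
    destruct (HX (letter j) (INR (deg j (pad m w))) (letter_mem j Hj)) as [t [H1 [H2 H3]]].
    - rewrite deg_pad. destruct (deg j w) as [|d]; [left; now rewrite Nat.mul_0_r|].
      right. left. apply Rlt_le_trans with (1 := Hm). apply le_INR. lia.
    - apply pos_INR.
    - exists t. intros _. split; [exact H1|split; [exact H2|]].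
      destruct (cheap_scale _ (2 * m + 1) _ (deg j (pad m w)) B (H j Hj)) as [i [Hi [Him Hb]]].
      + rewrite deg_pad. lia.
      + specialize (H3 i Hi Him). fold C in Hb. lra. }
  pose (t := fun j => proj1_sig (constructive_indefinite_description _ (Ht j))).
  assert (Hs : forall j, (j < length Sigma)%nat ->
    0 <= t j /\ wfun Phi mem k (letter j) (t j) = INR (deg j (pad m w)) /\ t j <= C * B).
  { intros j. unfold t. exact (proj2_sig (constructive_indefinite_description _ (Ht j))). }
  exists (maxR (length Sigma) t). split.
  - apply maxR_le; [nra|]. intros i Hi. now apply Hs.
  - exists (pad m w). split; [now apply pad_valid|]. split; [apply pad_eval|].
    exists t. split; [|reflexivity]. intros i Hi. destruct (Hs i Hi) as [H1 [H2 _]]. auto.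
Qed.

End Geometry.

(** * Comparison of the two geometries *)

(** The number of selected letters is the sum of the degrees of the selected indices, of which there
    are at most [n]. *)
Lemma length_filter_letters (f : nat -> bool) (D : nat) (w : list (nat * bool)) n :
  (forall i, (i < n)%nat -> f i = true -> (deg i w <= D)%nat) ->
  Forall (fun a => (fst a < n)%nat) w ->
  (length (filter (fun a => f (fst a)) w) <= n * D)%nat.
Proof.
  intros H V.
  assert (X : forall m, (m <= n)%nat ->
    (length (filter (fun a => f (fst a) && (fst a <? m)%nat)%bool w) <= m * D)%nat).
  { induction m as [|m IH]; intros Hm.
    - replace (filter _ w) with (@nil (nat * bool)); [simpl; lia|]. clear.
      induction w as [|a w IH]; [reflexivity|]. simpl. rewrite <- IH.
      now rewrite Bool.andb_false_r.
    - specialize (IH ltac:(lia)).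
      assert (Y : (length (filter (fun a => f (fst a) && (fst a <? S m)%nat)%bool w) <=
        length (filter (fun a => f (fst a) && (fst a <? m)%nat)%bool w) +
        if f m then deg m w else 0)%nat).
      { clear. unfold deg. induction w as [|a w IH]; simpl; [lia|].
        destruct (Nat.eqb_spec (fst a) m) as [->|N].
        - destruct (f m); simpl; [|exact IH].
          destruct (Nat.ltb_spec m (S m)); [|lia]. destruct (Nat.ltb_spec m m); [lia|].
          simpl in *. lia.
        - destruct (f (fst a)); simpl; [|exact IH].
          destruct (Nat.ltb_spec (fst a) (S m)); destruct (Nat.ltb_spec (fst a) m);
          simpl in *; lia. }
      specialize (H m ltac:(lia)). destruct (f m); [specialize (H eq_refl)|]; lia. }
  specialize (X n (le_n n)). eapply Nat.le_trans; [|exact X]. clear X H.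
  induction V as [|a w Ha V IH]; simpl; [lia|].
  apply Nat.ltb_lt in Ha. rewrite Ha, Bool.andb_true_r.
  destruct (f (fst a)); simpl; lia.
Qed.

Section Transfer.
Variables (G : group) (Phi : nat -> R -> R) (k : nat).
Variables (N : G -> Prop) (H : nat -> G -> Prop).
Variables (u : list G) (Sg : nat -> list G) (Xi0 SigG SigN : list G).
Hypothesis profile : forall i, (i <= k)%nat -> weight_profile (Phi i).
Hypothesis Phi_le_Phi0 : forall i, (i <= k)%nat ->
  exists K, 1 <= K /\ forall x, 0 <= x -> Phi i x <= K * Phi 0%nat x.
Hypothesis N_subgroup : is_subgroup G N.
Hypothesis N_normal : is_normal G N.
Hypothesis N_nilpotent : is_nilpotent G N.
Hypothesis u_nonempty : u <> [].
Hypothesis u_0 : nth 0 u gone = gone.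
Hypothesis u_cosets :
  forall g : G, exists! l, (l < length u)%nat /\ N (gmul g (ginv (nth l u gone))).
Hypothesis S0_gen : fin_sym_gen G (fun _ => True) (Sg 0%nat).
Hypothesis Si_gen :
  forall i, (1 <= i <= k)%nat -> fin_sym_gen G (fun x => N x /\ H i x) (Sg i).
Hypothesis Xi0_gen : fin_sym_gen G N Xi0.

Let memG (i : nat) (x : G) := In x (Sg i).
Let memN := Xi_mem u Sg Xi0.

Hypothesis SigG_rep :
  rep_set G (fun x => (exists i, (i <= k)%nat /\ memG i x) /\ x <> gone) SigG.
Hypothesis SigN_rep :
  rep_set G (fun x => (exists i, (i <= k)%nat /\ memN i x) /\ x <> gone) SigN.

Lemma memG_inv i x : (i <= k)%nat -> memG i x -> memG i (ginv x).
Proof.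
  intros Hi. destruct (Nat.eq_dec i 0) as [->|Hi0]; [apply S0_gen|].
  apply (Si_gen i). lia.
Qed.

Lemma memG_N i x : (1 <= i <= k)%nat -> memG i x -> N x.
Proof. intros Hi Hx. now apply (Si_gen i Hi). Qed.

Lemma memN_conj i l x : (1 <= i)%nat -> (l < length u)%nat -> memG i x ->
  memN i (gmul (gmul (nth l u gone) x) (ginv (nth l u gone))).
Proof. intros Hi Hl Hx. destruct i; [lia|]. exists l. eauto. Qed.

Lemma memN_inv i x : (i <= k)%nat -> memN i x -> memN i (ginv x).
Proof.
  intros Hi. destruct i as [|i]; [apply Xi0_gen|].
  intros [l [Hl [s [Hs ->]]]]. rewrite !ginvM, ginvK, <- gmulAr.
  apply memN_conj; [lia|exact Hl|]. now apply memG_inv.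
Qed.

Lemma memN_N i x : (i <= k)%nat -> memN i x -> N x.
Proof.
  intros Hi. destruct i as [|i]; [apply Xi0_gen|].
  intros [l [Hl [s [Hs ->]]]]. apply N_normal, (memG_N (S i)); [lia|exact Hs].
Qed.

Lemma SigN_N s : In s SigN -> N s.
Proof.
  intros Hs. destruct SigN_rep as [_ [H2 _]]. destruct (H2 s Hs) as [[i [Hi Hm]] _].
  now apply (memN_N i).
Qed.

Lemma word_eval_N w : valid SigN w -> N (word_eval G SigN w).
Proof.
  destruct N_subgroup as [N1 [NM NV]].
  unfold word_eval. induction 1 as [|a w Ha V IH]; simpl; [exact N1|].
  apply NM; [|exact IH].
  assert (N (nth (fst a) SigN gone)) by (now apply SigN_N, nth_In).
  unfold letter_val. destruct (snd a); auto.
Qed.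

Lemma Phi_le_Phi0_uniform : exists K, 1 <= K /\
  forall i x, (i <= k)%nat -> 0 <= x -> Phi i x <= K * Phi 0%nat x.
Proof.
  destruct (finite_upper_bound_R
    (fun i K => 1 <= K /\ forall x, 0 <= x -> Phi i x <= K * Phi 0%nat x) (S k)) as [K HK].
  - intros i x y [H1 H2] L. split; [lra|]. intros z Hz.
    apply Rle_trans with (1 := H2 z Hz). apply Rmult_le_compat_r; [|exact L].
    rewrite <- (profile_0 _ (profile 0%nat ltac:(lia))) at 1.
    apply (profile_mono _ (profile 0%nat ltac:(lia))); lra.
  - intros i Hi. apply Phi_le_Phi0. lia.
  - exists K. split; [apply (HK 0%nat); lia|]. intros i x Hi. apply (HK i). lia.
Qed.

(** * From G to N: rewriting over coset representatives *)

Section Schreier.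
Variable K : R.
Hypothesis K_ge_1 : 1 <= K.
Hypothesis K_bound : forall i x, (i <= k)%nat -> 0 <= x -> Phi i x <= K * Phi 0%nat x.

(* For all [n], [F_sigma^-1(n) <= K F_s^-1(n)]. *)
Definition controlled (sigma s : G) : Prop :=
  forall i, (i <= k)%nat -> memG i s -> exists j, (j <= k)%nat /\ memN j sigma /\
    forall y, 0 <= y -> Phi j y <= K * Phi i y.

(* A letter in some [S_i] with [i >= 1] lies in [N] and does not change the coset, so it becomes a
   single letter of [Xi_i]; the other letters only have weight [Phi_0]. *)
Lemma schreier_letter a l : (fst a < length SigG)%nat -> (l < length u)%nat ->
  exists v l', (l' < length u)%nat /\ valid SigN v /\
    gmul (nth l u gone) (letter_val G SigG a) = gmul (word_eval G SigN v) (nth l' u gone) /\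
    forall b, In b v -> controlled (nth (fst b) SigN gone) (nth (fst a) SigG gone).
Proof.
  intros Ha Hl. set (s := nth (fst a) SigG gone). set (x := letter_val G SigG a).
  assert (HxS : forall i, (i <= k)%nat -> memG i s -> memG i x).
  { intros i Hi Hm. unfold x, letter_val. destruct (snd a); [now apply memG_inv|exact Hm]. }
  destruct (classic (exists j, (1 <= j <= k)%nat /\ memG j s)) as [[j [Hj Hm]]|Hno].
  - set (z := gmul (gmul (nth l u gone) x) (ginv (nth l u gone))).
    assert (Hs : s <> gone) by (apply (letter_nontrivial G k SigG memG SigG_rep); exact Ha).
    assert (Hx : x <> gone).
    { unfold x, letter_val. destruct (snd a); [|exact Hs]. intros E. apply Hs.
      change (ginv s = gone) in E. now rewrite <- (ginvK G s), E, ginv1. }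
    assert (Hz : z <> gone).
    { intros E. apply Hx.
      replace x with (gmul (gmul (ginv (nth l u gone)) z) (nth l u gone)) by (unfold z; grp).
      rewrite E. grp. }
    destruct (letter_of G k SigN memN memN_inv SigN_rep z Hz) as [b [Hb [Eb Mb]]].
    { exists j. split; [lia|]. apply memN_conj; [lia|exact Hl|]. apply HxS; [lia|exact Hm]. }
    exists [b], l. split; [exact Hl|split; [now constructor|split]].
    + unfold word_eval. simpl. rewrite Eb. unfold z. grp.
    + intros b' [<-|[]] i Hi Hmi.
      destruct (Nat.eq_dec i 0) as [->|Hi0].
      (* A letter may lie in S_0 and in S_j at once; its Phi_0 cost is then matched by Phi_j <= K
         Phi_0. *)
      * exists j. split; [lia|split].
        -- apply Mb; [lia|]. apply memN_conj; [lia|exact Hl|]. apply HxS; [lia|exact Hm].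
        -- intros y Hy. apply K_bound; [lia|exact Hy].
      * exists i. split; [exact Hi|split].
        -- apply Mb; [exact Hi|]. apply memN_conj; [lia|exact Hl|]. now apply HxS.
        -- intros y Hy. pose proof (Phi_nonneg Phi k profile i y Hi Hy). nra.
  - destruct (u_cosets (gmul (nth l u gone) x)) as [l' [[Hl' HN] _]].
    destruct (word_of_elt G k SigN memN memN_inv SigN_rep 0 N Xi0 _ ltac:(lia) Xi0_gen
      (fun s H => H) HN) as [v [V [E M]]].
    exists v, l'. split; [exact Hl'|split; [exact V|split]].
    + rewrite E. grp.
    + intros b Ib i Hi Hmi. destruct (Nat.eq_dec i 0) as [->|Hi0].
      * exists 0%nat. split; [lia|split; [now apply M|]].
        intros y Hy. pose proof (Phi_nonneg Phi k profile 0%nat y Hi Hy). nra.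
      * exfalso. apply Hno. exists i. split; [lia|exact Hmi].
Qed.

Lemma schreier_letter_uniform : exists L, forall a l,
  (fst a < length SigG)%nat -> (l < length u)%nat ->
  exists v l', (l' < length u)%nat /\ valid SigN v /\ (length v <= L)%nat /\
    gmul (nth l u gone) (letter_val G SigG a) = gmul (word_eval G SigN v) (nth l' u gone) /\
    forall b, In b v -> controlled (nth (fst b) SigN gone) (nth (fst a) SigG gone).
Proof.
  set (P := fun a l L => exists v l', (l' < length u)%nat /\ valid SigN v /\ (length v <= L)%nat /\
    gmul (nth l u gone) (letter_val G SigG a) = gmul (word_eval G SigN v) (nth l' u gone) /\
    forall b, In b v -> controlled (nth (fst b) SigN gone) (nth (fst a) SigG gone)).
  assert (MP : forall a l x y, P a l x -> (x <= y)%nat -> P a l y).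
  { intros a l x y [v [l' [H1 [H2 [H3 H4]]]]] L. exists v, l'. repeat split; try tauto; lia. }
  destruct (finite_upper_bound_nat (fun i L => forall c l, (l < length u)%nat -> P (i, c) l L)
    (length SigG)) as [L HL].
  - intros i x y Hx L c l Hl. apply MP with x; auto.
  - intros i Hi.
    assert (X : forall c, exists L, forall l, (l < length u)%nat -> P (i, c) l L).
    { intros c. apply finite_upper_bound_nat; [intros l x y; apply MP|].
      intros l Hl. destruct (schreier_letter (i, c) l Hi Hl) as [v [l' [H1 [H2 [H3 H4]]]]].
      exists (length v), v, l'. repeat split; auto. }
    destruct (X true) as [L1 H1]. destruct (X false) as [L2 H2].
    exists (Nat.max L1 L2). intros [] l Hl; eapply MP; eauto; lia.
  - exists L. intros [i c] l Ha Hl. now apply (HL i).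
Qed.

Definition controlledb (j i : nat) : bool :=
  if excluded_middle_informative (controlled (nth j SigN gone) (nth i SigG gone))
  then true else false.

(** Schreier rewriting carries the representative from left to right, at most [L] new letters per
    step. A letter of [SigN] arises only from letters of [SigG] controlling it, so its degree is
    charged to these alone. *)
Lemma schreier_word : exists L, forall w, valid SigG w -> forall l, (l < length u)%nat ->
  exists v l', (l' < length u)%nat /\ valid SigN v /\
    gmul (nth l u gone) (word_eval G SigG w) = gmul (word_eval G SigN v) (nth l' u gone) /\
    forall j, (deg j v <= L * length (filter (fun a => controlledb j (fst a)) w))%nat.
Proof.
  destruct schreier_letter_uniform as [L HL]. exists L.
  induction 1 as [|a w Ha V IH]; intros l Hl.
  - exists [], l. split; [exact Hl|split; [constructor|split]].
    + unfold word_eval; simpl. grp.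
    + intros j. unfold deg; simpl; lia.
  - destruct (HL a l Ha Hl) as [v1 [l1 [Hl1 [V1 [Hv1 [E1 C1]]]]]].
    destruct (IH l1 Hl1) as [v2 [l2 [Hl2 [V2 [E2 D2]]]]].
    exists (v1 ++ v2), l2. split; [exact Hl2|split; [now apply Forall_app|split]].
    + rewrite word_eval_app, gmulAr, <- E2, gmulA, <- E1.
      change (word_eval G SigG (a :: w)) with (gmul (letter_val G SigG a) (word_eval G SigG w)).
      grp.
    + intros j. rewrite deg_app. specialize (D2 j). simpl filter. unfold controlledb at 1.
      destruct (excluded_middle_informative _) as [Y|Y].
      * simpl length. pose proof (deg_le_length j v1). lia.
      * assert (deg j v1 = 0%nat); [|lia].
        destruct (Nat.eq_dec (deg j v1) 0) as [|D]; [assumption|exfalso].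
        destruct (deg_pos j v1 ltac:(lia)) as [b [Ib <-]]. apply Y. now apply C1.
Qed.

Lemma cheap_G_to_N : exists C, 1 <= C /\ forall w B, 0 <= B -> cheap_word G Phi k SigG memG w B ->
  N (word_eval G SigG w) ->
  exists v, cheap_word G Phi k SigN memN v (C * B) /\ word_eval G SigN v = word_eval G SigG w.
Proof.
  destruct schreier_word as [L HL].
  set (c := (L * length SigG)%nat). set (C := (INR c + 1) ^ 2).
  assert (HC : 1 <= C) by (unfold C; pose proof (pos_INR c); nra).
  exists (C * K). split; [nra|]. intros w B HB [V Hw] HN.
  assert (Hu : (0 < length u)%nat) 
    by (apply Nat.neq_0_lt_0; intros Z; apply u_nonempty, length_zero_iff_nil, Z).
  destruct (HL w V 0%nat Hu) as [v [l' [Hl' [Vv [E D]]]]].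
  rewrite u_0, gmul1l in E.
  (* The word represents an element of N, so the final representative lies in N and must be
     [u_0 = e]. *)
  assert (E0 : l' = 0%nat).
  { set (y := nth l' u gone) in *.
    destruct N_subgroup as [N1 [NM NV]].
    assert (Hy : N y).
    { replace y with (gmul (ginv (word_eval G SigN v)) (word_eval G SigG w)) by (rewrite E; grp).
      apply NM; [apply NV, word_eval_N; exact Vv|exact HN]. }
    destruct (u_cosets y) as [m [_ Hm]].
    rewrite <- (Hm l'), <- (Hm 0%nat); [reflexivity| |].
    - split; [exact Hu|]. rewrite u_0, ginv1, gmul1r. exact Hy.
    - split; [exact Hl'|]. fold y. rewrite gmulVr. exact N1. }
  exists v. split; [|rewrite E, E0, u_0; grp].
  split; [exact Vv|]. intros j Hj.
  (* [Dj] is the largest degree among the letters controlling letter [j], or 0. Control transfers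
     the index bounding that degree to letter [j], at the cost of [K]. *)
  assert (HD : exists Dj, (forall i, (i < length SigG)%nat -> controlledb j i = true ->
    (deg i w <= Dj)%nat) /\ cheap G Phi k memN (nth j SigN gone) Dj (K * B)).
  { assert (Hn : forall n, (n <= length SigG)%nat -> exists Dj,
      (forall i, (i < n)%nat -> controlledb j i = true -> (deg i w <= Dj)%nat) /\
      cheap G Phi k memN (nth j SigN gone) Dj (K * B)).
    { induction n as [|n IH]; intros Hn.
      - exists 0%nat. split; [intros; lia|].
        apply (cheap_zero G Phi k SigN memN profile SigN_rep); [exact Hj|nra].
      - destruct (IH ltac:(lia)) as [Dj [H1 H2]].
        destruct (le_lt_dec (deg n w) Dj) as [Le|Lt].
        + exists Dj. split; [|exact H2]. intros i Hi Hc.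
          destruct (Nat.eq_dec i n) as [->|]; [exact Le|apply H1; auto; lia].
        + destruct (controlledb j n) eqn:Ec.
          * exists (deg n w). split.
            -- intros i Hi Hc. destruct (Nat.eq_dec i n) as [->|]; [lia|].
               specialize (H1 i ltac:(lia) Hc). lia.
            -- unfold controlledb in Ec.
               destruct (excluded_middle_informative _) as [Y|Y]; [|discriminate].
               destruct (Hw n ltac:(lia)) as [i [Hi [Hm Hb]]].
               destruct (Y i Hi Hm) as [i' [Hi' [Hm' Hb']]].
               exists i'. split; [exact Hi'|split; [exact Hm'|]].
               apply Rle_trans with (1 := Hb' _ (pos_INR _)). apply Rmult_le_compat_l; lra.
          * exists Dj. split; [|exact H2]. intros i Hi Hc.
            destruct (Nat.eq_dec i n) as [->|]; [congruence|apply H1; auto; lia]. }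
    apply Hn. lia. }
  destruct HD as [Dj [H1 H2]].
  rewrite Rmult_assoc. apply (cheap_scale G Phi k memN profile _ c Dj); [exact H2|].
  eapply Nat.le_trans; [apply D|]. unfold c. rewrite <- Nat.mul_assoc.
  apply Nat.mul_le_mono_l. now apply length_filter_letters.
Qed.

End Schreier.

(** * From N to G: spelling out powers of letters *)

Lemma word_S0 x : exists w, valid SigG w /\ word_eval G SigG w = x /\
  forall a, In a w -> memG 0 (nth (fst a) SigG gone).
Proof.
  apply (word_of_elt G k SigG memG memG_inv SigG_rep 0 (fun _ => True) (Sg 0%nat));
  [lia|exact S0_gen|easy|trivial].
Qed.

Lemma word_S0_uniform (f : nat -> G) n : exists L, forall i, (i < n)%nat ->
  exists w, valid SigG w /\ word_eval G SigG w = f i /\ (length w <= L)%nat /\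
  forall a, In a w -> memG 0 (nth (fst a) SigG gone).
Proof.
  apply finite_upper_bound_nat.
  - intros i x y [w [H1 [H2 [H3 H4]]]] L. exists w. repeat split; auto. lia.
  - intros i _. destruct (word_S0 (f i)) as [w [H1 [H2 H3]]].
    exists (length w), w. repeat split; auto.
Qed.

(* [(u s u^-1)^x = u s^x u^-1]: a power costs only boundedly many letters of [S_0] besides [s^x]. *)
Lemma cheap_block (C0 : nat) : exists C, 1 <= C /\ forall w B, 1 <= B ->
  cheap_word G Phi k SigN memN w B -> forall a x,
  (fst a < length SigN)%nat -> (x <= C0 * deg (fst a) w)%nat ->
  exists v, cheap_word G Phi k SigG memG v (C * B) /\
    word_eval G SigG v = gpow (letter_val G SigN a) x.
Proof.
  destruct (word_S0_uniform (fun j => letter_val G SigN (j, false)) (length SigN)) as [L1 HL1].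
  destruct (word_S0_uniform (fun j => letter_val G SigN (j, true)) (length SigN)) as [L2 HL2].
  destruct (word_S0_uniform (fun l => nth l u gone) (length u)) as [L3 HL3].
  destruct (word_S0_uniform (fun l => ginv (nth l u gone)) (length u)) as [L4 HL4].
  set (L := (L1 + L2)%nat). set (M := Phi 0%nat (INR (L3 + L4))).
  assert (HM : 0 <= M) by (apply (Phi_nonneg Phi k profile); [lia|apply pos_INR]).
  set (A := (INR (L * C0) + 1) ^ 2). set (A' := (INR C0 + 1) ^ 2).
  assert (HA : 1 <= A) by (unfold A; pose proof (pos_INR (L * C0)); nra).
  assert (HA' : 1 <= A') by (unfold A'; pose proof (pos_INR C0); nra).
  (* [A] pays for spelling a power over S_0; [A'] for a power of s, and [M] for the conjugators,
     absorbed because [B >= 1]. The factor 81 comes from two concatenations. *)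
  exists (A + 81 * (A' + M)). split; [lra|]. intros w B HB [V Hw] a x Ha Hx.
  (* The index making this degree cheap decides the spelling: over S_0 for [i = 0], and as a
     conjugated power from S_i otherwise. *)
  destruct (Hw (fst a) Ha) as [i [Hi [Hm Hb]]]. destruct (Nat.eq_dec i 0) as [->|Hi0].
  - assert (X : exists v, valid SigG v /\ word_eval G SigG v = letter_val G SigN a /\
      (length v <= L)%nat /\ forall b, In b v -> memG 0 (nth (fst b) SigG gone)).
    { destruct a as [j []]; simpl in Ha.
      - destruct (HL2 j Ha) as [v [H1 [H2 [H3 H4]]]]. exists v. unfold L. repeat split; auto; lia.
      - destruct (HL1 j Ha) as [v [H1 [H2 [H3 H4]]]]. exists v. unfold L. repeat split; auto; lia. }
    destruct X as [v [V' [E [Lv Mv]]]].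
    exists (concat (repeat v x)). split; [|now rewrite word_eval_concat_repeat, E].
    eapply cheap_word_le; [|apply (cheap_word_uniform G Phi k SigG memG profile SigG_rep 0);
      [exact Hi|now apply Forall_concat_repeat|]].
    + rewrite length_concat_repeat.
      apply Rle_trans with (A * Phi 0%nat (INR (deg (fst a) w))).
      * apply (profile_scale_INR Phi k profile); [exact Hi|]. nia.
      * apply Rle_trans with (A * B); [apply Rmult_le_compat_l; lra|].
        apply Rmult_le_compat_r; lra.
    + intros b Ib. apply in_concat in Ib as [v' [I1 I2]]. apply repeat_spec in I1 as ->. auto.
  - assert (X : exists l y, (l < length u)%nat /\ memG i y /\
      letter_val G SigN a = gmul (gmul (nth l u gone) y) (ginv (nth l u gone))).
    { destruct i as [|i]; [lia|]. destruct Hm as [l [Hl [s [Hs Es]]]].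
      unfold letter_val. destruct (snd a).
      - exists l, (ginv s). split; [exact Hl|split; [now apply memG_inv|]]. rewrite Es. grp.
      - exists l, s. auto. }
    destruct X as [l [y [Hl [My Ey]]]]. rewrite Ey, gpow_conj.
    destruct (HL3 l Hl) as [v1 [V1 [E1 [Le1 M1]]]].
    destruct (HL4 l Hl) as [v3 [V3 [E3 [Le3 M3]]]].
    destruct (word_of_list G k SigG memG memG_inv SigG_rep i (repeat y x) Hi) as [v2 [V2 [E2 [Le2 M2]]]].
    { apply Forall_forall. intros z Iz. now apply repeat_spec in Iz as ->. }
    rewrite repeat_length in Le2. rewrite gprod_repeat in E2.
    assert (HS : forall v, valid SigG v -> (length v <= L3 + L4)%nat ->
      (forall b, In b v -> memG 0 (nth (fst b) SigG gone)) ->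
      cheap_word G Phi k SigG memG v ((A' + M) * B)).
    { intros v Vv Lv Mv.
      eapply cheap_word_le; [|apply (cheap_word_uniform G Phi k SigG memG profile SigG_rep 0);
        [lia|exact Vv|exact Mv]].
      apply Rle_trans with M; [|nra].
      apply (profile_mono _ (profile 0%nat ltac:(lia))); [apply pos_INR|now apply le_INR]. }
    assert (H2 : cheap_word G Phi k SigG memG v2 ((A' + M) * B)).
    { eapply cheap_word_le; [|apply (cheap_word_uniform G Phi k SigG memG profile SigG_rep i);
        [exact Hi|exact V2|exact M2]].
      apply Rle_trans with (A' * Phi i (INR (deg (fst a) w))).
      - apply (profile_scale_INR Phi k profile); [exact Hi|lia].
      - apply Rle_trans with (A' * B); [apply Rmult_le_compat_l; lra|].
        apply Rmult_le_compat_r; lra. }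
    exists ((v1 ++ v2) ++ v3). split; [|now rewrite !word_eval_app, E1, E2, E3].
    assert (H1 : cheap_word G Phi k SigG memG v1 ((A' + M) * B)) by (apply HS; auto; lia).
    assert (H3 : cheap_word G Phi k SigG memG v3 ((A' + M) * B)) by (apply HS; auto; lia).
    assert (HP : 0 <= (A' + M) * B) by nra.
    eapply cheap_word_le; [|apply (cheap_word_app G Phi k SigG memG profile);
      [apply (cheap_word_app G Phi k SigG memG profile); eassumption|
       eapply cheap_word_le; [|exact H3]; lra]].
    nra.
Qed.

Lemma cheap_N_to_G : exists C, 1 <= C /\ forall w B, w <> [] -> cheap_word G Phi k SigN memN w B ->
  exists v, cheap_word G Phi k SigG memG v (C * B) /\ word_eval G SigG v = word_eval G SigN w.
Proof.
  destruct (nilpotent_word_powers G N SigN N_subgroup N_nilpotent SigN_N) as [Q [C0 HQ]].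
  destruct (cheap_block C0) as [C1 [HC1 Hblock]].
  destruct (cheap_word_lower G Phi k SigN memN profile) as [K [HK Hlow]].
  assert (H9 : 1 <= 9 ^ Q) by (apply pow_R1_Rle; lra).
  assert (HC : 1 <= C1 * K) by nra.
  (* [K] lifts the weight to at least 1, [C1] is the cost of a block, and each of the at most [Q]
     concatenations costs a factor 9. *)
  exists (9 ^ Q * (C1 * K)). split; [nra|]. intros w B Hw Hc.
  specialize (Hlow w B Hw Hc).
  assert (HB : 0 < B) by nra.
  assert (Hc' : cheap_word G Phi k SigN memN w (K * B)).
  { eapply cheap_word_le; [|exact Hc]. nra. }
  destruct Hc' as [V Hd]. destruct (HQ w V) as [bl [[Hlen Hbl] E]]. rewrite <- E.
  assert (X : exists v, cheap_word G Phi k SigG memG v (9 ^ length bl * (C1 * (K * B))) /\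
    word_eval G SigG v = block_val G (letter_val G SigN) bl).
  { clear E Hlen. induction bl as [|[a x] bl IH].
    - exists []. split; [apply (cheap_word_nil G Phi k SigG memG profile SigG_rep)|reflexivity].
      simpl. nra.
    - destruct IH as [v [Hv Ev]]; [intros b Ib; apply Hbl; now right|].
      specialize (Hbl (a, x) (or_introl eq_refl)). simpl in Hbl.
      assert (Y : exists v', cheap_word G Phi k SigG memG v' (C1 * (K * B)) /\
        word_eval G SigG v' = gpow (letter_val G SigN a) x).
      { destruct (Nat.eq_dec x 0) as [->|Hx].
        - exists []. split; [|reflexivity].
          apply (cheap_word_nil G Phi k SigG memG profile SigG_rep). nra.
        - assert (Hpos : (0 < deg (fst a) w)%nat) by nia.
          destruct (deg_pos _ _ Hpos) as [b [Ib Eb]].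
          apply (Hblock w (K * B) Hlow (conj V Hd)); [|exact Hbl].
          rewrite <- Eb. apply (proj1 (Forall_forall _ _) V b Ib). }
      destruct Y as [v' [Hv' Ev']].
      assert (1 <= 9 ^ length bl) by (apply pow_R1_Rle; lra).
      exists (v' ++ v). split.
      + simpl (9 ^ _). rewrite Rmult_assoc. apply (cheap_word_app G Phi k SigG memG profile); [|exact Hv].
        eapply cheap_word_le; [|exact Hv']. assert (0 <= C1 * (K * B)) by nra. nra.
      + rewrite word_eval_app, Ev', Ev. reflexivity. }
  destruct X as [v [Hv Ev]]. exists v. split; [|exact Ev].
  eapply cheap_word_le; [|exact Hv].
  assert (9 ^ length bl <= 9 ^ Q) by (apply Rle_pow; [lra|exact Hlen]).
  assert (0 <= C1 * (K * B)) by nra.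
  replace (9 ^ Q * (C1 * K) * B) with (9 ^ Q * (C1 * (K * B))) by ring.
  apply Rmult_le_compat_r; assumption.
Qed.

Theorem wnorm_comparison : exists c C, 0 < c /\ c <= C /\ forall g : G, N g ->
  ((exists x, is_wnorm G SigG (wsys Phi memG k SigG) g x) <->
   (exists y, is_wnorm G SigN (wsys Phi memN k SigN) g y)) /\
  (forall x y, is_wnorm G SigG (wsys Phi memG k SigG) g x ->
     is_wnorm G SigN (wsys Phi memN k SigN) g y -> c * x <= y /\ y <= C * x).
Proof.
  destruct Phi_le_Phi0_uniform as [K [HK1 HK]].
  destruct (cheap_G_to_N K HK1 HK) as [C1 [HC1 T1]].
  destruct cheap_N_to_G as [C2 [HC2 T2]].
  destruct (cheap_wnorm_vals G Phi k SigG memG profile SigG_rep) as [D1 [HD1 V1]].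
  destruct (cheap_wnorm_vals G Phi k SigN memN profile SigN_rep) as [D2 [HD2 V2]].
  set (valsG := wnorm_vals G SigG (wsys Phi memG k SigG)).
  set (valsN := wnorm_vals G SigN (wsys Phi memN k SigN)).
  assert (GN : forall g r, N g -> valsG g r -> exists r', r' <= D2 * C1 * r /\ valsN g r').
  { intros g r Hg Hr.
    destruct (wnorm_vals_cheap G Phi k SigG memG profile SigG_rep g r Hr) as [Hr0 [w [Hw E]]].
    destruct (T1 w r Hr0 Hw) as [v [Hv Ev]]; [now rewrite E|].
    destruct (V2 v (C1 * r) ltac:(nra) Hv) as [r' [H1 H2]].
    exists r'. split; [lra|]. rewrite Ev, E in H2. exact H2. }
  (* For [g <> gone] the word is nonempty, which gives the lower bound on its weight. *)
  assert (NG : forall g r, g <> gone -> valsN g r -> exists r', r' <= D1 * C2 * r /\ valsG g r').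
  { intros g r Hg Hr.
    destruct (wnorm_vals_cheap G Phi k SigN memN profile SigN_rep g r Hr) as [Hr0 [w [Hw E]]].
    destruct (T2 w r) as [v [Hv Ev]]; [intros ->; apply Hg; now rewrite <- E|exact Hw|].
    destruct (V1 v (C2 * r) ltac:(nra) Hv) as [r' [H1 H2]].
    exists r'. split; [lra|]. rewrite Ev, E in H2. exact H2. }
  (* S_0 generates G, so both norms are finite on N, the second one through [GN]. *)
  assert (EG : forall g, exists r, valsG g r).
  { intros g. destruct (word_S0 g) as [w [V [E _]]].
    destruct (cheap_word_exists G Phi k SigG memG SigG_rep w V) as [B [HB Hc]].
    destruct (V1 w B HB Hc) as [r [_ Hr]]. exists r. rewrite E in Hr. exact Hr. }
  assert (HDC1 : 1 <= D2 * C1) by nra. assert (HDC2 : 1 <= D1 * C2) by nra.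
  exists (/ (D1 * C2)), (D2 * C1).
  assert (0 < / (D1 * C2) <= 1).
  { split; [apply Rinv_0_lt_compat; lra|]. rewrite <- Rinv_1. apply Rinv_le_contravar; lra. }
  split; [lra|split; [lra|]]. intros g Hg.
  destruct (classic (g = gone)) as [Eg|Ng].
  - split; [split; intros _; exists 0; left; auto|].
    intros x y [[_ ->]|[F _]] [[_ ->]|[F' _]]; try contradiction. lra.
  - split.
    + assert (XG : exists x, is_wnorm G SigG (wsys Phi memG k SigG) g x).
      { destruct (glb_exists (valsG g)) as [x Hx]; [apply EG| |exists x; right; auto].
        intros r Hr. apply (wnorm_vals_cheap G Phi k SigG memG profile SigG_rep g r Hr). }
      assert (XN : exists y, is_wnorm G SigN (wsys Phi memN k SigN) g y).
      { destruct (glb_exists (valsN g)) as [x Hx]; [| |exists x; right; auto].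
        - destruct (EG g) as [r Hr]. destruct (GN g r Hg Hr) as [r' [_ Hr']]. eauto.
        - intros r Hr. apply (wnorm_vals_cheap G Phi k SigN memN profile SigN_rep g r Hr). }
      tauto.
    + intros x y [[F _]|[_ [X1 X2]]] [[F' _]|[_ [Y1 Y2]]]; try contradiction. split.
      * apply Y2. intros r Hr. destruct (NG g r Ng Hr) as [r' [H1 H2]].
        specialize (X1 r' H2). apply (Rmult_le_reg_l (D1 * C2)); [lra|].
        rewrite <- Rmult_assoc, Rinv_r, Rmult_1_l by lra. lra.
      * assert (y / (D2 * C1) <= x).
        { apply X2. intros r Hr. destruct (GN g r Hg Hr) as [r' [H1 H2]].
          specialize (Y1 r' H2). apply (Rmult_le_reg_l (D2 * C1)); [lra|].
          replace (D2 * C1 * (y / (D2 * C1))) with y by (field; lra). lra. }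
        apply (Rmult_le_compat_l (D2 * C1)) in H1; [|lra].
        replace (D2 * C1 * (y / (D2 * C1))) with y in H1 by (field; lra). lra.
Qed.

End Transfer.

Theorem mainTheorem6
  (G : group)
  (* ---- the measure mu in P_(G, reg) ---- *)
  (k : nat) (p : nat -> R) (mu : nat -> G -> R) (phi : nat -> R -> R)
  (H : nat -> G -> Prop) (T : nat -> list G) (d : nat -> nat)
  (hG : exists (S' : list G) (d0 : nat),
          fin_sym_gen G (fun _ => True) S' /\ poly_growth G S' d0)
  (hp0 : 0 <= p 0%nat)
  (hp : forall i, (1 <= i <= k)%nat -> 0 < p i)
  (hpsum : fold_right Rplus 0 (map p (seq 0 (S k))) = 1)
  (hmu : forall i, (i <= k)%nat -> sym_prob G (mu i))
  (hmu0 : exists L : list G, forall g, mu 0%nat g <> 0 -> In g L)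
  (hH : forall i, (1 <= i <= k)%nat ->
     is_subgroup G (H i) /\ fin_sym_gen G (H i) (T i) /\ poly_growth G (T i) (d i) /\
     (forall t, 0 <= t -> 0 < phi i t) /\
     (forall s t, 0 <= s -> s <= t -> phi i s <= phi i t) /\
     regularly_varying_pos (phi i) /\
     (exists c1 c2, 0 < c1 /\ 0 < c2 /\ forall h n, H i h -> wlen G (T i) h n ->
        c1 * / (phi i (1 + INR n) * (1 + INR n) ^ (d i)) <= mu i h /\
        mu i h <= c2 * / (phi i (1 + INR n) * (1 + INR n) ^ (d i))) /\
     (forall h, ~ H i h -> mu i h = 0))
  (hcomp : forall i j, (1 <= i <= k)%nat -> (1 <= j <= k)%nat -> i <> j ->
     prec_inf (PhiAll phi i) (PhiAll phi j) \/ prec_inf (PhiAll phi j) (PhiAll phi i))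
  (heps : exists eps, 0 < eps /\ exists L : list G,
     (forall g, In g L <->
        eps < fold_right Rplus 0 (map (fun i => p i * mu i g) (seq 0 (S k)))) /\
     In gone L /\ (forall g, gen_by G (fun a => In a L) g))
  (* ---- adapted pair of geometries ---- *)
  (N : G -> Prop) (u : list G) (Sg : nat -> list G) (Xi0 SigG SigN : list G)
  (hN : is_subgroup G N /\ is_normal G N /\ is_nilpotent G N)
  (hu : u <> [] /\ nth 0 u gone = gone /\
        forall g : G, exists! l, (l < length u)%nat /\ N (gmul g (ginv (nth l u gone))))
  (hS0 : fin_sym_gen G (fun _ => True) (Sg 0%nat))
  (hS : forall i, (1 <= i <= k)%nat -> fin_sym_gen G (fun x => N x /\ H i x) (Sg i))
  (hSigG : rep_set G (fun x => (exists i, (i <= k)%nat /\ In x (Sg i)) /\ x <> gone) SigG)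
  (hXi0 : fin_sym_gen G N Xi0)
  (hSigN : rep_set G (fun x => (exists i, (i <= k)%nat /\ Xi_mem u Sg Xi0 i x) /\ x <> gone)
             SigN) :
  let FG := wsys (PhiAll phi) (fun i x => In x (Sg i)) k SigG in
  let FN := wsys (PhiAll phi) (Xi_mem u Sg Xi0) k SigN in
  exists c C, 0 < c /\ c <= C /\
    forall g : G, N g ->
      ((exists x, is_wnorm G SigG FG g x) <-> (exists y, is_wnorm G SigN FN g y)) /\
      (forall x y, is_wnorm G SigG FG g x -> is_wnorm G SigN FN g y ->
         c * x <= y /\ y <= C * x).
Proof.
  destruct hN as [N1 [N2 N3]]. destruct hu as [u1 [u2 u3]].
  assert (profile : forall i, (i <= k)%nat -> weight_profile (PhiAll phi i)).
  { intros [|i] Hi; [exact weight_profile_Phi0|].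
    destruct (hH (S i) ltac:(lia)) as [_ [_ [_ [P1 [P2 [P3 _]]]]]].
    exact (weight_profile_PhiReg (phi (S i)) P1 P2 P3). }
  apply (wnorm_comparison G (PhiAll phi) k N H u Sg Xi0 SigG SigN); try assumption.
  (* max(x, x^2) is Phi_0. *)
  intros i Hi. exact (profile_quadratic _ (profile i Hi)).
Qed.
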